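(* Let $(H_a,\mu_a,\chi_a)$ and $(H_b,\mu_b,\chi_b)$ be triplets, each consisting of a countable discrete abelian group $\neq\{0\}$, a normalized scalar $2$-cocycle of it and a character of it. Let $\beta_a=\beta(H_a,\mu_a,\chi_a)$ and $\beta_b=\beta(H_b,\mu_b,\chi_b)$ be the associated twisted Bernoulli shift actions of $\mathbb{Z}^2\rtimes\mathrm{SL}(2,\mathbb{Z})$ on $N(H_a,\mu_a)$ and $N(H_b,\mu_b)$. Denote by $u(\lambda)$, $\lambda\in\Lambda(H_a)$, and $v(\sigma)$, $\sigma\in\Lambda(H_b)$, the canonical unitaries of $N(H_a,\mu_a)$ and $N(H_b,\mu_b)$ respectively. If $\pi\colon N(H_a,\mu_a)\to N(H_b,\mu_b)$ is a $*$-isomorphism giving conjugacy between $\beta_a$ and $\beta_b$, then there exists a group isomorphism $\phi=\phi_\pi\colon H_a\to H_b$ satisfying: (1) for every $\lambda\in\Lambda(H_a)$, $\pi(u(\lambda))=v(\phi\circ\lambda)$ modulo $\mathbb{T}$ (i.e. up to a scalar in $\mathbb{T}$); (2) the $2$-cocycles $\mu_a(\cdot,\cdot)$ and $\mu_b(\phi(\cdot),\phi(\cdot))$ of $H_a$ are cohomologous; (3) $\chi_a^2=(\chi_b\circ\phi)^2$. Conversely, given a group isomorphism $\phi\colon H_a\to H_b$ satisfying (2) and (3), there exists a $*$-isomorphism $\pi=\pi_\phi\colon N(H_a,\mu_a)\to N(H_b,\mu_b)$ which satisfies (1) and gives conjugacy between $\beta_a$ and $\beta_b$.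
   Context: Notation. $\mathbb{T}=\{z\in\mathbb{C}: |z|=1\}$. Let $H\neq\{0\}$ be a countable discrete abelian group (written additively), $\mu\colon H\times H\to\mathbb{T}$ a scalar $2$-cocycle which is normalized ($\mu(g,0)=\mu(0,g)=1$), and $\chi\colon H\to\mathbb{T}$ a character. For a discrete group $\Lambda$ with scalar $2$-cocycle $\nu$, the twisted group von Neumann algebra $L_\nu(\Lambda)$ is generated by unitaries $u(\lambda)$, $\lambda\in\Lambda$, on $\ell^2\Lambda$ with $u(\lambda)\delta_g=\nu(\lambda,g)\delta_{\lambda g}$, and carries the faithful normal trace $\langle\,\cdot\,\delta_e,\delta_e\rangle$. $\Lambda(H)$ is the abelian group (pointwise addition) of finitely supported functions $\lambda\colon\mathbb{Z}^2\to H$ with $\sum_{k\in\mathbb{Z}^2}\lambda(k)=0$. Put $\widetilde\mu(\lambda_1,\lambda_2)=\prod_{k\in\mathbb{Z}^2}\mu(\lambda_1(k),\lambda_2(k))$ and $N(H,\mu)=L_{\widetilde\mu}(\Lambda(H))$, with canonical unitaries $u(\lambda)$, $\lambda\in\Lambda(H)$. For $k=(q,r)^T$, $k_0=(q_0,r_0)^T\in\mathbb{Z}^2$ put $\det(k,k_0)=qr_0-rq_0$. The group $\mathbb{Z}^2\rtimes\mathrm{SL}(2,\mathbb{Z})$ acts on $\mathbb{Z}^2$ by $(k,\gamma)\cdot l=k+\gamma l$, and on functions by $((k,\gamma)\cdot\lambda)(l)=\lambda((k,\gamma)^{-1}\cdot l)$. The twisted Bernoulli shift action $\beta=\beta(H,\mu,\chi)$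 is the trace preserving action of $\mathbb{Z}^2\rtimes\mathrm{SL}(2,\mathbb{Z})$ on $N(H,\mu)$ determined by $\beta(k,\gamma)=\beta(k)\circ\beta(\gamma)$, where for $k\in\mathbb{Z}^2$, $\gamma\in\mathrm{SL}(2,\mathbb{Z})$, $\lambda\in\Lambda(H)$, $$\beta(\gamma)(u(\lambda))=u(\gamma\cdot\lambda),\qquad \beta(k)(u(\lambda))=\Big(\prod_{m\in\mathbb{Z}^2}\chi(\lambda(m))^{\det(k,m)}\Big)u(k\cdot\lambda).$$ A $*$-isomorphism $\pi$ (not assumed trace preserving) gives conjugacy between two actions $\beta_a,\beta_b$ if $\pi\circ\beta_a(\gamma)=\beta_b(\gamma)\circ\pi$ for all $\gamma\in\mathbb{Z}^2\rtimes\mathrm{SL}(2,\mathbb{Z})$. *)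

(* Defs.v *)
From HB Require Import structures.
From mathcomp Require Import all_boot all_order all_algebra finmap complex ring.
From mathcomp Require Import all_classical all_reals ereal esum numfun.

Set Implicit Arguments.
Unset Strict Implicit.
Unset Printing Implicit Defensive.

Import Order.TTheory GRing.Theory Num.Theory.

Local Open Scope classical_set_scope.
Local Open Scope ring_scope.

(** * The Hilbert space l^2(I) *)

Section SquareSummable.
Variables (R : realType) (I : choiceType).
Implicit Types f g : I -> R[i].

Definition sqnorm f : \bar R :=
  (\esum_(i in [set: I]) (Normc.normc (f i) ^+ 2)%:E)%E.

Definition sqsummable : {pred I -> R[i]} := fun f => `[< (sqnorm f < +oo)%E >].

Lemma le_normc_sqrD (x y : R[i]) : Normc.normc (x + y) ^+ 2 <=
  (Normc.normc x ^+ 2 + Normc.normc y ^+ 2) +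
  (Normc.normc x ^+ 2 + Normc.normc y ^+ 2).
Proof.
case: x y => [a b] [c d] /=.
rewrite !sqr_sqrtr ?addr_ge0 ?sqr_ge0// -subr_ge0.
have -> : a ^+ 2 + b ^+ 2 + (c ^+ 2 + d ^+ 2) +
    (a ^+ 2 + b ^+ 2 + (c ^+ 2 + d ^+ 2)) -
    ((a + c) ^+ 2 + (b + d) ^+ 2) = (a - c) ^+ 2 + (b - d) ^+ 2 by ring.
by rewrite addr_ge0 ?sqr_ge0.
Qed.

Lemma le_sqnormD f g : (sqnorm (fun i => f i + g i)%R <=
  (sqnorm f + sqnorm g) + (sqnorm f + sqnorm g))%E.
Proof.
rewrite /sqnorm -!esumD.
- by apply: le_esum => i _; rewrite -!EFinD lee_fin le_normc_sqrD.
all: by move=> i _; rewrite -?EFinD lee_fin ?addr_ge0 ?sqr_ge0.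
Qed.

Lemma le_sqnormZ (c : R[i]) f : (sqnorm (fun i => c * f i)%R <=
  (Normc.normc c ^+ 2)%:E * sqnorm f)%E.
Proof.
apply: ge_ereal_sup => _ [A [finA _] <-].
rewrite fsbig_finite//= (eq_bigr (fun i => ((Normc.normc c ^+ 2)%:E *
    (Normc.normc (f i) ^+ 2)%:E)%E)); last first.
  by move=> i _; rewrite Normc.normcM exprMn EFinM.
rewrite -ge0_sume_distrr; last by move=> i _; rewrite lee_fin sqr_ge0.
apply: lee_wpmul2l; first by rewrite lee_fin sqr_ge0.
apply: ereal_sup_ubound; exists A; first by split.
by rewrite fsbig_finite.
Qed.

Fact sqsummable_zmod : zmod_closed sqsummable.
Proof.
split.
- apply/asboolP; rewrite /sqnorm esum1 ?ltry// => i _.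
  by rewrite Normc.normc0 expr0n.
- move=> f g /asboolP f2 /asboolP g2; apply/asboolP.
  have Ng2 : sqnorm (- g) = sqnorm g.
    by apply: eq_esum => i _; rewrite normcN.
  apply: le_lt_trans (le_sqnormD f (- g)) _.
  by rewrite Ng2 !lte_add_pinfty.
Qed.
HB.instance Definition _ :=
  GRing.isZmodClosed.Build (I -> R[i]) sqsummable sqsummable_zmod.

End SquareSummable.

Section HilbertSpace.
Variables (R : realType) (I : choiceType).

Record l2 := L2 { l2val :> I -> R[i]; l2valP : l2val \in @sqsummable R I }.
HB.instance Definition _ := [isSub for l2val].
HB.instance Definition _ := [Choice of l2 by <:].
HB.instance Definition _ := [SubChoice_isSubZmodule of l2 by <:].

Fact l2_scale_subproof (c : R[i]) (f : l2) :
  (fun i => c * f i) \in @sqsummable R I.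
Proof.
apply/asboolP; apply: le_lt_trans (le_sqnormZ c f) _.
apply: lte_mul_pinfty; rewrite ?lee_fin ?sqr_ge0//.
by have /asboolP := l2valP f.
Qed.
Definition l2_scale c f := L2 (l2_scale_subproof c f).

Fact l2_scaleA c d f : l2_scale c (l2_scale d f) = l2_scale (c * d) f.
Proof. by apply: val_inj; apply/funext => i /=; rewrite mulrA. Qed.
Fact l2_scale1 : left_id 1 l2_scale.
Proof. by move=> f; apply: val_inj; apply/funext => i /=; rewrite mul1r. Qed.
Fact l2_scaleDr : right_distributive l2_scale +%R.
Proof.
by move=> c f g; apply: val_inj; apply/funext => i /=; rewrite mulrDr.
Qed.
Fact l2_scaleDl f : {morph l2_scale^~ f : c d / c + d}.
Proof.
by move=> c d; apply: val_inj; apply/funext => i /=; rewrite mulrDl.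
Qed.
HB.instance Definition _ := GRing.Zmodule_isLmodule.Build R[i] l2
  l2_scaleA l2_scale1 l2_scaleDr l2_scaleDl.

(* The sum of an absolutely summable family, the only case used below. *)
Definition rsum (a : I -> R) : R :=
  fine (\esum_(i in [set: I]) (EFin \o a)^\+ i -
        \esum_(i in [set: I]) (EFin \o a)^\- i)%E.
Definition csum (a : I -> R[i]) : R[i] :=
  Complex (rsum (fun i => complex.Re (a i))) (rsum (fun i => complex.Im (a i))).

Definition inner (f g : l2) : R[i] := csum (fun i => f i * (g i)^*%C).

Definition l2norm (f : l2) : R := Num.sqrt (fine (sqnorm f)).

Fact delta_subproof (j : I) : (fun i => (i == j)%:R) \in @sqsummable R I.
Proof.
apply/asboolP; rewrite /sqnorm (esumID [set j])/=; last first.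
  by move=> i _; rewrite lee_fin sqr_ge0.
rewrite setTI esum_set1 ?lee_fin ?sqr_ge0// esum1 ?adde0 ?ltry//.
by move=> i [_ /= /eqP/negPf ->]; rewrite Normc.normc0 expr0n.
Qed.
Definition delta (j : I) : l2 := L2 (delta_subproof j).

End HilbertSpace.
Arguments delta {R I}.

(** * von Neumann algebras on l^2(I) *)

Section VonNeumann.
Variables (R : realType) (I : choiceType).
Notation op := (l2 R I -> l2 R I).

Definition bounded_op : set op :=
  [set T | linear T /\ exists M : R, forall f, l2norm (T f) <= M * l2norm f].

(* For bounded T the operator S is unique, and this says S = T^* . *)
Definition is_adjoint (T S : op) : Prop :=
  forall f g, inner (T f) g = inner f (S g).

Definition commutant (X : set op) : set op :=
  [set T | bounded_op T /\ forall A, X A -> T \o A = A \o T].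

Definition adjoints (X : set op) : set op :=
  [set S | bounded_op S /\ exists2 T, X T & is_adjoint T S].

(* By the bicommutant theorem this is the smallest von Neumann algebra
   containing X. *)
Definition vN_generated (X : set op) : set op :=
  commutant (commutant (X `|` adjoints X)).

End VonNeumann.

(* Only the values of pi on M matter. Preservation of the unit follows from
   bijectivity and multiplicativity, and no continuity or compatibility with
   traces is required. *)
Definition star_isomorphism (R : realType) (I J : choiceType)
    (M : set (l2 R I -> l2 R I)) (N : set (l2 R J -> l2 R J))
    (pi : (l2 R I -> l2 R I) -> (l2 R J -> l2 R J)) : Prop :=
  [/\ set_bij M N pi,
      forall x y, M x -> M y -> pi (x + y) = pi x + pi y,
      forall (c : R[i]) x, M x -> pi (c *: x) = c *: pi x,
      forall x y, M x -> M y -> pi (x \o y) = pi x \o pi y &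
      forall x y, M x -> M y -> is_adjoint x y -> is_adjoint (pi x) (pi y)].

(** * Cocycles, characters and twisted group von Neumann algebras *)

Record cocycle (R : realType) (G : zmodType) := Cocycle {
  cocycle_fun :> G -> G -> R[i];
  cocycle_norm : forall g h, `|cocycle_fun g h| = 1;
  cocycleP : forall g h k, cocycle_fun g h * cocycle_fun (g + h) k =
                           cocycle_fun h k * cocycle_fun g (h + k);
  cocycleg0 : forall g, cocycle_fun g 0 = 1;
  cocycle0g : forall g, cocycle_fun 0 g = 1 }.

Definition cohomologous (R : realType) (G : zmodType)
    (mu nu : G -> G -> R[i]) : Prop :=
  exists b : G -> R[i], (forall g, `|b g| = 1) /\
    forall g h, mu g h = b g * b h * (b (g + h))^-1 * nu g h.

Record character (R : realType) (G : zmodType) := Character {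
  character_fun :> G -> R[i];
  character_norm : forall g, `|character_fun g| = 1;
  characterD : forall g h,
    character_fun (g + h) = character_fun g * character_fun h }.

Section TwistedGroupAlgebra.
Variables (R : realType) (G : zmodType) (nu : cocycle R G).

Fact canonical_subproof (x : G) (f : l2 R G) :
  (fun g => nu x (g - x) * f (g - x)) \in @sqsummable R G.
Proof.
have /asboolP f2 := l2valP f; apply/asboolP.
rewrite (_ : sqnorm _ = sqnorm f)// /sqnorm.
rewrite [RHS](reindex_esum [set: G] _ (fun g => g - x)).
  apply: eq_esum => g _; rewrite Normc.normcM.
  have := cocycle_norm nu x (g - x).
  by move=> /(congr1 (@complex.Re R)) /= ->; rewrite mul1r.
split=> [//|g h _ _ /addIr//|g _]; exists (g + x) => //=.
by rewrite addrK.
Qed.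

(* The unitary u(x) with u(x) delta_g = nu(x,g) delta_(x+g). *)
Definition canonical (x : G) : l2 R G -> l2 R G :=
  fun f => L2 (canonical_subproof x f).

Lemma canonical_delta (x g : G) :
  canonical x (delta g) = nu x g *: delta (x + g).
Proof.
apply: val_inj; apply/funext => h /=.
rewrite subr_eq [g + x]addrC; have [->|] := eqVneq h (x + g).
  by rewrite addrAC subrr add0r.
by rewrite !mulr0.
Qed.

Definition twisted_vN : set (l2 R G -> l2 R G) :=
  vN_generated (range canonical).

Definition trace (x : l2 R G -> l2 R G) : R[i] :=
  inner (x (delta 0)) (delta 0).

End TwistedGroupAlgebra.

(** * The group Z^2 x| SL(2,Z) *)

Notation Z2 := 'cV[int]_2.

Definition det2 (k l : Z2) : int :=
  k 0 0 * l 1 0 - k 1 0 * l 0 0.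

Record SL2Z := SL2ZMx { SL2Zval :> 'M[int]_2; SL2ZP : \det SL2Zval == 1 }.
HB.instance Definition _ := [isSub for SL2Zval].
HB.instance Definition _ := [Choice of SL2Z by <:].

Fact SL2Z_one_subproof : \det (1%:M : 'M[int]_2) == 1.
Proof. by rewrite det1. Qed.
Fact SL2Z_mul_subproof (g h : SL2Z) : \det (g *m h) == 1.
Proof. by rewrite det_mulmx (eqP (SL2ZP g)) (eqP (SL2ZP h)). Qed.
Fact SL2Z_inv_subproof (g : SL2Z) : \det (invmx g) == 1.
Proof. by rewrite det_inv (eqP (SL2ZP g)) invr1. Qed.
Definition SL2Z_one := SL2ZMx SL2Z_one_subproof.
Definition SL2Z_mul g h := SL2ZMx (SL2Z_mul_subproof g h).
Definition SL2Z_inv g := SL2ZMx (SL2Z_inv_subproof g).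

Lemma SL2Z_unit (g : SL2Z) : SL2Zval g \in unitmx.
Proof. by rewrite unitmxE (eqP (SL2ZP g)) unitr1. Qed.
Fact SL2Z_mulA : associative SL2Z_mul.
Proof. by move=> x y z; apply: val_inj; rewrite /= mulmxA. Qed.
Fact SL2Z_mul1 : left_id SL2Z_one SL2Z_mul.
Proof. by move=> x; apply: val_inj; rewrite /= mul1mx. Qed.
Fact SL2Z_mulr1 : right_id SL2Z_one SL2Z_mul.
Proof. by move=> x; apply: val_inj; rewrite /= mulmx1. Qed.
Fact SL2Z_mulV : left_inverse SL2Z_one SL2Z_inv SL2Z_mul.
Proof. by move=> x; apply: val_inj; rewrite /= mulVmx ?SL2Z_unit. Qed.
Fact SL2Z_mulrV : right_inverse SL2Z_one SL2Z_inv SL2Z_mul.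
Proof. by move=> x; apply: val_inj; rewrite /= mulmxV ?SL2Z_unit. Qed.
HB.instance Definition _ := isGroup.Build SL2Z
  SL2Z_mulA SL2Z_mul1 SL2Z_mulr1 SL2Z_mulV SL2Z_mulrV.

(* Aff k g is the element (k, g) of the semidirect product. *)
Record affine := Aff { aff_tr : Z2; aff_lin : SL2Z }.
Definition aff_pair (g : affine) := (aff_tr g, aff_lin g).
Definition pair_aff (p : Z2 * SL2Z) := Aff p.1 p.2.
Fact aff_pairK : cancel aff_pair pair_aff. Proof. by case. Qed.
HB.instance Definition _ := Choice.copy affine (can_type aff_pairK).

Definition aff_one := Aff 0 1%g.
Definition aff_mul (g h : affine) :=
  Aff (aff_tr g + aff_lin g *m aff_tr h) (aff_lin g * aff_lin h)%g.
Definition aff_inv (g : affine) :=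
  Aff (- ((aff_lin g)^-1%g *m aff_tr g)) (aff_lin g)^-1%g.

Fact aff_mulA : associative aff_mul.
Proof.
move=> [k g] [l h] [m i]; rewrite /aff_mul /=.
by rewrite mulgA mulmxDr addrA mulmxA.
Qed.
Fact aff_mul1 : left_id aff_one aff_mul.
Proof. by move=> [k g]; rewrite /aff_mul /= mul1g mul1mx add0r. Qed.
Fact aff_mulr1 : right_id aff_one aff_mul.
Proof. by move=> [k g]; rewrite /aff_mul /= mulg1 mulmx0 addr0. Qed.
Fact aff_mulV : left_inverse aff_one aff_inv aff_mul.
Proof. by move=> [k g]; rewrite /aff_mul /= mulVg addNr. Qed.
Fact aff_mulrV : right_inverse aff_one aff_inv aff_mul.
Proof.
move=> [k g]; rewrite /aff_mul /= mulgV mulmxN mulmxA.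
by rewrite mulmxV ?SL2Z_unit// mul1mx subrr.
Qed.
HB.instance Definition _ := isGroup.Build affine
  aff_mulA aff_mul1 aff_mulr1 aff_mulV aff_mulrV.

Definition aff_act (g : affine) (l : Z2) : Z2 := aff_tr g + aff_lin g *m l.

Lemma aff_act1 l : aff_act 1%g l = l.
Proof. by rewrite /aff_act /= mul1mx add0r. Qed.
Lemma aff_actM g h l : aff_act (g * h)%g l = aff_act g (aff_act h l).
Proof. by rewrite /aff_act /= mulmxDr addrA mulmxA. Qed.
Lemma aff_actK g : cancel (aff_act g) (aff_act g^-1%g).
Proof. by move=> l; rewrite -aff_actM mulVg aff_act1. Qed.
Lemma aff_actKV g : cancel (aff_act g^-1%g) (aff_act g).
Proof. by move=> l; rewrite -aff_actM mulgV aff_act1. Qed.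

(** * The group Lambda(H) *)

Section Lambda.
Variable H : zmodType.

Definition lambda_pred : {pred Z2 -> H} := fun f =>
  `[< finite_set [set k | f k != 0] /\ \sum_(k \in [set: Z2]) f k = 0 >].

Fact fsum_sub (f g : Z2 -> H) : finite_set [set k | f k != 0] ->
  finite_set [set k | g k != 0] ->
  \sum_(k \in [set: Z2]) (f k - g k) =
  \sum_(k \in [set: Z2]) f k - \sum_(k \in [set: Z2]) g k.
Proof.
move=> ff fg; set A := [set k | f k != 0] `|` [set k | g k != 0].
have fA : finite_set A by rewrite finite_setU.
have widen (h : Z2 -> H) : (forall k, f k = 0 -> g k = 0 -> h k = 0) ->
    \sum_(k \in [set: Z2]) h k = \sum_(k \in A) h k.
  move=> hP; apply/esym/fsbig_widen => // k [_] /= nA; apply: hP.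
    by apply/eqP; apply: contra_notT nA => ?; left.
  by apply/eqP; apply: contra_notT nA => ?; right.
rewrite !widen//; last by move=> k -> ->; rewrite subrr.
by rewrite !fsbig_finite//= sumrB.
Qed.

Fact lambda_zmod : zmod_closed lambda_pred.
Proof.
split.
- apply/asboolP; split; last by apply: fsbig1.
  rewrite (_ : [set k | _] = set0); first exact: finite_set0.
  by apply/seteqP; split=> // k /=; rewrite eqxx.
- move=> f g /asboolP[ff f0] /asboolP[fg g0]; apply/asboolP; split.
  + apply: (@sub_finite_set _ _ ([set k | f k != 0] `|` [set k | g k != 0])).
      move=> k fgk; apply: contrapT => /not_orP[].
      move=> /negP/negbNE/eqP fk /negP/negbNE/eqP gk.
      by move: fgk; rewrite /mkset (_ : _ k = f k - g k)// fk gk subrr eqxx.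
    by rewrite finite_setU.
  + by rewrite (fsum_sub ff fg) f0 g0 subrr.
Qed.
HB.instance Definition _ :=
  GRing.isZmodClosed.Build (Z2 -> H) lambda_pred lambda_zmod.

Record Lambda := MkLambda {
  Lambdaval :> Z2 -> H; LambdaP : Lambdaval \in lambda_pred }.
HB.instance Definition _ := [isSub for Lambdaval].
HB.instance Definition _ := [Choice of Lambda by <:].
HB.instance Definition _ := [SubChoice_isSubZmodule of Lambda by <:].

Fact Lambda_act_subproof (g : affine) (x : Lambda) :
  (fun l => x (aff_act g^-1%g l)) \in lambda_pred.
Proof.
have /asboolP[fx x0] := LambdaP x; apply/asboolP; split.
- rewrite (_ : [set k | _] = aff_act g @` [set k | x k != 0]).
    exact: finite_image.
  apply/seteqP; split => [k /= xk|_ [k /= xk <-]]; last by rewrite aff_actK.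
  by exists (aff_act g^-1%g k) => //; rewrite aff_actKV.
- rewrite -[RHS]x0 [RHS](reindex_fsbigT (aff_act g^-1%g))//.
  by exists (aff_act g); [exact: aff_actKV|exact: aff_actK].
Qed.
Definition Lambda_act (g : affine) (x : Lambda) : Lambda :=
  MkLambda (Lambda_act_subproof g x).

End Lambda.

Fact Lambda_map_subproof (H K : zmodType) (phi : {additive H -> K})
  (x : Lambda H) : (fun l => phi (x l)) \in @lambda_pred K.
Proof.
have /asboolP[fx x0] := LambdaP x.
have fphi : [set k | phi (x k) != 0] `<=` [set k | x k != 0].
  by move=> k /=; apply: contra => /eqP ->; rewrite raddf0.
apply/asboolP; split; first exact: sub_finite_set fphi fx.
have wid (L : zmodType) (f : Z2 -> L) : (forall k, x k = 0 -> f k = 0) ->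
    \sum_(k \in [set: Z2]) f k = \sum_(k \in [set k | x k != 0]) f k.
  move=> fP; apply/esym/fsbig_widen => // k [_] /= /negP; rewrite negbK => /eqP.
  exact: fP.
rewrite wid; last by move=> k ->; rewrite raddf0.
by rewrite fsbig_finite//= -raddf_sum -fsbig_finite// -wid// x0 raddf0.
Qed.
Definition Lambda_map (H K : zmodType) (phi : {additive H -> K})
  (x : Lambda H) : Lambda K := MkLambda (Lambda_map_subproof phi x).

(** * The algebra N(H, mu) and the twisted Bernoulli shift *)

Section TwistedBernoulli.
Variables (R : realType) (H : zmodType).
Variables (mu : cocycle R H) (chi : character R H).

Definition mut (x y : Lambda H) : R[i] :=
  \big[*%R/1]_(k \in [set: Z2]) mu (x k) (y k).

Fact mut_widen (A : set Z2) (x y : Lambda H) : finite_set A ->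
  (forall k, ~ A k -> x k = 0 \/ y k = 0) ->
  mut x y = \prod_(k <- fset_set A) mu (x k) (y k).
Proof.
move=> fA AP; rewrite -fsbig_finite//; apply/esym/fsbig_widen => //.
by move=> k [_] /= /AP[] ->; rewrite ?cocycle0g ?cocycleg0.
Qed.

Fact Lambda_finite (x : Lambda H) : finite_set [set k | x k != 0].
Proof. by have /asboolP[] := LambdaP x. Qed.

Fact mut_norm x y : `|mut x y| = 1.
Proof.
rewrite (mut_widen (Lambda_finite x)).
  by rewrite normr_prod big1// => k _; rewrite cocycle_norm.
by move=> k /= /negP; rewrite negbK => /eqP; left.
Qed.

Fact mutP x y z : mut x y * mut (x + y) z = mut y z * mut x (y + z).
Proof.
set A := [set k | x k != 0] `|` [set k | y k != 0] `|` [set k | z k != 0].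
have fA : finite_set A by rewrite !finite_setU; split; [split|]; exact: Lambda_finite.
have AP k : ~ A k -> [/\ x k = 0, y k = 0 & z k = 0].
  by move=> nA; split; apply/eqP; apply: contra_notT nA => ?;
    [left; left|left; right|right].
rewrite !(mut_widen fA); try by move=> k /AP[xk yk zk]; (by left) || by right.
by rewrite -!big_split; apply: eq_bigr => k _ /=; rewrite cocycleP.
Qed.

Fact mutg0 x : mut x 0 = 1.
Proof. by apply: fsbig1 => k _; rewrite cocycleg0. Qed.
Fact mut0g x : mut 0 x = 1.
Proof. by apply: fsbig1 => k _; rewrite cocycle0g. Qed.

Definition mu_tilde : cocycle R (Lambda H) :=
  Cocycle mut_norm mutP mutg0 mut0g.

Definition N_vN : set (l2 R (Lambda H) -> l2 R (Lambda H)) :=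
  twisted_vN mu_tilde.

Definition N_unitary (x : Lambda H) : l2 R (Lambda H) -> l2 R (Lambda H) :=
  canonical mu_tilde x.

Definition twist (k : Z2) (x : Lambda H) : R[i] :=
  \big[*%R/1]_(m \in [set: Z2]) chi (x m) ^ det2 k m.

(* The first three clauses say that beta is a trace preserving action by
   *-automorphisms (only its values on N_vN matter); the action law gives
   beta (k, gamma) = beta (k, 1) o beta (0, gamma), and the last two clauses
   determine beta on the generators. *)
Definition twisted_bernoulli
    (beta : affine -> (l2 R (Lambda H) -> l2 R (Lambda H)) ->
                      (l2 R (Lambda H) -> l2 R (Lambda H))) : Prop :=
  [/\ forall g, star_isomorphism N_vN N_vN (beta g),
      forall g x, N_vN x -> trace (beta g x) = trace x,
      (forall x, N_vN x -> beta 1%g x = x) /\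
      (forall g h x, N_vN x -> beta (g * h)%g x = beta g (beta h x)),
      forall (gamma : SL2Z) x,
        beta (Aff 0 gamma) (N_unitary x) =
        N_unitary (Lambda_act (Aff 0 gamma) x) &
      forall (k : Z2) x,
        beta (Aff k 1%g) (N_unitary x) =
        twist k x *: N_unitary (Lambda_act (Aff k 1%g) x)].

End TwistedBernoulli.

Definition conjugates (R : realType) (Ha Hb : zmodType)
    (mua : cocycle R Ha)
    (betaa : affine -> (l2 R (Lambda Ha) -> l2 R (Lambda Ha)) ->
                       (l2 R (Lambda Ha) -> l2 R (Lambda Ha)))
    (betab : affine -> (l2 R (Lambda Hb) -> l2 R (Lambda Hb)) ->
                       (l2 R (Lambda Hb) -> l2 R (Lambda Hb)))
    (pi : (l2 R (Lambda Ha) -> l2 R (Lambda Ha)) ->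
          (l2 R (Lambda Hb) -> l2 R (Lambda Hb))) : Prop :=
  forall g x, N_vN mua x -> pi (betaa g x) = betab g (pi x).

(* Main.v *)
(* Elements of N(H, mu) are determined by their Fourier coefficients, and an
   automorphism [beta g] permutes the coefficients up to phases, because it
   preserves the trace. Write lam(k, l; h) = h d_k - h d_l. The image
   x = pi (u (lam(0, e1; h))) is fixed by the unipotent matrices fixing e1, and
   square summability then confines its coefficients to functions carried by the
   line Z e1. The same holds for the other two sides of the triangle 0, e1, e2,
   and u (lam(0, e1; h)) u (lam(e1, e2; h)) is proportional to
   u (lam(0, e2; h)). As the three lines meet only in the vertices, comparing
   coefficients leaves a single one: x = c v (lam(0, e1; h')), and phi h = h'.
   Affine images of these two-point functions generate Lambda(H), so that
   pi (u x) = c(x) v (phi o x) for all x.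

   The function c exhibits the quotient of the two cocycles on Lambda(H) as a
   coboundary. Hence the quotient on H is symmetric, and it is a coboundary since
   the circle is divisible. After this correction c becomes a character of
   Lambda(H), invariant under SL(2,Z), and
   F(k) = c(lam(k, 0; g)) satisfies F(k + m) = F(k) F(m) r^det(m, k) with
   r = chi_b(phi g) / chi_a(g). The left side is symmetric in k and m, so r^2 = 1.

   Conversely, if r^2 = 1, then F(k) = 1 for k in 2 Z^2 and F(k) = r otherwise
   is an SL(2,Z)-invariant solution of this equation. It gives the phases of a
   unitary that permutes the canonical bases along phi and implements pi. *)

Require Import Defs.
From HB Require Import structures.
From mathcomp Require Import all_boot all_order all_algebra finmap complex ring zify.
From mathcomp Require Import all_classical all_reals ereal esum numfun.

Set Implicit Arguments.
Unset Strict Implicit.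
Unset Printing Implicit Defensive.

Import Order.TTheory GRing.Theory Num.Theory.

Local Open Scope classical_set_scope.
Local Open Scope ring_scope.

Local Notation normc := Normc.normc.

(** * Norms, coordinates and finite approximation in l^2 *)

Lemma linearZ_op (R : realType) (I J : choiceType) (T : l2 R I -> l2 R J)
  (c : R[i]) f : linear T ->
  T (c *: f) = c *: T f.
Proof.
move=> linT; have T0 : T 0 = 0.
  by have := linT (-1) 0 0; rewrite scaler0 addr0 scaleN1r addNr.
by rewrite -[c *: f]addr0 linT T0 addr0.
Qed.

Section L2Facts.
Variables (R : realType) (I : choiceType).
Implicit Types (f g : l2 R I) (T : l2 R I -> l2 R I).

Lemma normr_normc (x : R[i]) : `|x| = (normc x)%:C%C.
Proof. by []. Qed.

Lemma normc_ge0 (x : R[i]) : 0 <= normc x.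
Proof. by rewrite -ler0c -normr_normc. Qed.

Lemma normc1_norm (x : R[i]) : `|x| = 1 -> normc x = 1.
Proof. by move/(congr1 (@complex.Re R)). Qed.

Lemma l2P f g : (forall i, f i = g i) -> f = g.
Proof. by move=> fg; apply: val_inj; apply/funext. Qed.

Lemma l2D f g i : (f + g) i = f i + g i. Proof. by []. Qed.
Lemma l2B f g i : (f - g) i = f i - g i. Proof. by []. Qed.
Lemma l2Z (c : R[i]) f i : (c *: f) i = c * f i. Proof. by []. Qed.
Lemma l2_sum (J : Type) (r : seq J) (F : J -> l2 R I) i :
  (\sum_(j <- r) F j) i = \sum_(j <- r) F j i.
Proof. by elim/big_rec2: _ => // j x y _ <-; rewrite l2D. Qed.

Lemma sqnorm_ge0 (h : I -> R[i]) : (0 <= sqnorm h)%E.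
Proof. by apply: esum_ge0 => i _; rewrite lee_fin sqr_ge0. Qed.

Lemma sqnorm_fin f : sqnorm f \is a fin_num.
Proof.
by rewrite ge0_fin_numE ?sqnorm_ge0//; have /asboolP := l2valP f.
Qed.

Lemma l2norm_ge0 f : 0 <= l2norm f. Proof. exact: sqrtr_ge0. Qed.

Lemma l2norm_sqr f : (l2norm f ^+ 2)%:E = sqnorm f.
Proof. by rewrite /l2norm sqr_sqrtr ?fineK ?sqnorm_fin ?fine_ge0 ?sqnorm_ge0. Qed.

Lemma l2norm_le f (M : R) : 0 <= M -> (sqnorm f <= (M ^+ 2)%:E)%E ->
  l2norm f <= M.
Proof.
by move=> M0; rewrite -l2norm_sqr lee_fin ler_sqr ?nnegrE ?l2norm_ge0.
Qed.

Lemma le_coord_l2norm f i : normc (f i) <= l2norm f.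
Proof.
rewrite -ler_sqr ?nnegrE ?l2norm_ge0 ?normc_ge0// -lee_fin l2norm_sqr.
apply: esum_ge; exists [set i]; first by split => //; exact: finite_set1.
by rewrite fsbig_set1.
Qed.

(** N coordinates of modulus at least e contribute at least N e^2 to the squared norm. *)
Lemma finite_level_set f (e : R) : 0 < e ->
  finite_set [set i | e <= normc (f i)].
Proof.
move=> e0; apply: contrapT => inf.
have e20 : 0 < e ^+ 2 by rewrite exprn_gt0.
pose N := (Num.truncn (l2norm f ^+ 2 / e ^+ 2)).+1.
have [B BA cB] := @infinite_set_fset _ _ N inf.
have : ((e ^+ 2 *+ N)%:E <= sqnorm f)%E.
  apply: esum_ge; exists [set` B]; first by split.
  rewrite fsbig_finite//= set_fsetK sumEFin lee_fin.
  apply: (@le_trans _ _ (\sum_(i <- B) e ^+ 2)).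
    by rewrite big_const_seq count_predT iter_addr_0 ler_pMn2l.
  rewrite big_seq [leRHS]big_seq; apply: ler_sum => i /BA /= ei.
  by rewrite ler_sqr ?nnegrE ?normc_ge0// ltW.
rewrite -l2norm_sqr lee_fin -mulr_natl -ler_pdivlMr// leNgt.
by rewrite truncnS_gt.
Qed.

Lemma l2_approx f (t0 : I) (e : R) : 0 < e ->
  exists F : {fset I}, t0 \in F /\
    l2norm (f - \sum_(t <- F) f t *: delta t) <= e.
Proof.
move=> e0; have e20 : 0 < e ^+ 2 by rewrite exprn_gt0.
have [_ [A [fA _] <-]] := ub_ereal_sup_adherent e20 (sqnorm_fin f).
rewrite -/(esum _ _) -/(sqnorm f) => hA.
pose F := (t0 |` fset_set A)%fset; exists F; split; first exact: fset1U1.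
set g : l2 R I := f - _.
have AF : A `<=` [set` F].
  by move=> i Ai; rewrite /= in_fset1U in_fset_set// mem_set// orbT.
have gE i : g i =
    if i \in F then 0 else f i.
  rewrite /g l2B l2_sum; case: ifPn => iF.
    rewrite (big_fsetD1 i)//= eqxx mulr1 big1_seq ?addr0 ?subrr// => j.
    by rewrite !inE eq_sym => /and3P[_ /negPf -> _]; rewrite mulr0.
  rewrite big1_seq ?subr0// => j /andP[_ jF] /=.
  have [ij|] := eqVneq i j; last by rewrite mulr0.
  by rewrite ij jF in iF.
apply: l2norm_le; first exact: ltW.
have gsq : sqnorm g =
    (\esum_(i in [set: I] `&` ~` [set` F]) (normc (f i) ^+ 2)%:E)%E.
  rewrite esum_mkcondr; apply: eq_esum => i _; rewrite gE in_setC.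
  rewrite mem_setE; case: (i \in F); last by [].
  by rewrite Normc.normc0 expr0n.
(* The squared norm of [f] splits into its part on [F] and the squared norm of the remainder [g]. *)
have := esumID [set` F] [set: I] (fun i => (normc (f i) ^+ 2)%:E)
  (fun i _ => ltac:(by rewrite lee_fin sqr_ge0)).
rewrite -gsq -/(sqnorm f) setTI esum_fset//; last first.
  by move=> i _; rewrite lee_fin sqr_ge0.
have : (\sum_(i \in A) (normc (f i) ^+ 2)%:E <=
        \sum_(i \in [set` F]) (normc (f i) ^+ 2)%:E)%E.
  apply: lee_fsum_nneg_subset => //; first exact/subsetP.
  by move=> i _; rewrite lee_fin sqr_ge0.
move: hA; rewrite !fsbig_finite//= set_fsetK !sumEFin -(l2norm_sqr g) -(l2norm_sqr f).
rewrite -EFinB -EFinD !lee_fin lte_fin => h1 h2 [h3].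
by move: h1; rewrite h3 ltrBlDr; move/(fun h => lt_le_trans h (lerD h2 (lexx _)));
  rewrite ltrD2l => /ltW.
Qed.

Lemma linear_l2_sum T (J : Type) (r : seq J) (F : J -> l2 R I) : linear T ->
  T (\sum_(j <- r) F j) = \sum_(j <- r) T (F j).
Proof.
move=> linT; have T0 : T 0 = 0.
  by have := linT (-1) 0 0; rewrite scaler0 addr0 scaleN1r addNr.
by elim/big_rec2: _ => // j y x _ <-; rewrite -[F j]scale1r linT !scale1r.
Qed.

(* The finite truncations of [f] approximate it, and from some point on all of
   them have the same image in coordinate [s]. *)
Lemma bounded_op_coord T f (s t0 : I) : bounded_op T ->
  (forall t, t != t0 -> f t * T (delta t) s = 0) ->
  T f s = f t0 * T (delta t0) s.
Proof.
move=> [linT [M MT]] ft0.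
(* The bound [M] may be zero or negative; a positive one is wanted to divide by. *)
have M0 : 0 <= Num.max M 1 by rewrite le_max ler01 orbT.
have Mp : 0 < Num.max M 1 by rewrite lt_max ltr01 orbT.
apply/eqP; rewrite -subr_eq0; apply/eqP; apply: Normc.eq0_normc.
apply/eqP; rewrite eq_le normc_ge0 andbT; apply/ler_addgt0Pl => e e0.
rewrite addr0.
have [F [t0F Fe]] := @l2_approx f t0 (e / Num.max M 1) (divr_gt0 e0 Mp).
have -> : T f s - f t0 * T (delta t0) s =
    T (f - \sum_(t <- F) f t *: delta t) s.
  set S := \sum_(t <- F) _; have -> : f - S = -1 *: S + f.
    by rewrite scaleN1r addrC.
  rewrite linT scaleN1r addrC l2B; congr (_ - _); rewrite /S.
  rewrite linear_l2_sum// l2_sum.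
  rewrite (big_fsetD1 t0)//= linearZ_op// l2Z big1_seq ?addr0// => j.
  by rewrite !inE => /and3P[_ jt0 _]; rewrite linearZ_op// l2Z ft0.
apply: le_trans (le_coord_l2norm _ _) _; apply: le_trans (MT _) _.
apply: (@le_trans _ _ (Num.max M 1 * (e / Num.max M 1))).
  apply: le_trans (ler_wpM2l M0 Fe).
  by apply: ler_wpM2r; rewrite ?l2norm_ge0// le_max lexx.
by rewrite mulrCA divff ?mulr1// gt_eqF.
Qed.

End L2Facts.

(** * Sums with one nonzero term, inner products and adjoints *)

Section Sums.
Variables (R : realType) (I : choiceType).

Lemma rsum_single (a : I -> R) (j : I) :
  (forall i, i != j -> a i = 0) -> rsum a = a j.
Proof.
move=> aj.
have single (b : I -> \bar R) : (forall i, 0 <= b i)%E ->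
    (forall i, i != j -> b i = 0%E) -> (\esum_(i in [set: I]) b i = b j)%E.
  move=> b0 bj; rewrite (esumID [set j])// setTI esum_set1// esum1 ?adde0//.
  by move=> i [_ /= /eqP]; exact: bj.
rewrite /rsum !single.
- rewrite funeposE funenegE /= -!EFin_max -EFinB /=.
  have /orP[h|h] := le_total 0 (a j).
    by rewrite (max_l h) max_r ?subr0// oppr_le0.
  by rewrite (max_r h) max_l ?oppr_ge0// sub0r opprK.
- by move=> i; rewrite funeneg_ge0.
- by move=> i ij; rewrite funenegE /= aj// oppr0 maxxx.
- by move=> i; rewrite funepos_ge0.
- by move=> i ij; rewrite funeposE /= aj// maxxx.
Qed.

Lemma csum_single (a : I -> R[i]) (j : I) :
  (forall i, i != j -> a i = 0) -> csum a = a j.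
Proof.
move=> aj; rewrite /csum !(@rsum_single _ j); first by case: (a j).
all: by move=> i ij; rewrite aj.
Qed.

Lemma eq_csum (a b : I -> R[i]) : a =1 b -> csum a = csum b.
Proof. by move=> /funext ->. Qed.

Lemma inner_delta (f : l2 R I) j : inner f (delta j) = f j.
Proof.
rewrite /inner (csum_single (j := j)) /= ?eqxx ?rmorph1 ?mulr1// => i /negPf ->.
by rewrite rmorph0 mulr0.
Qed.

Lemma inner_deltal (f : l2 R I) j : inner (delta j) f = (f j)^*%C.
Proof.
rewrite /inner (csum_single (j := j)) /= ?eqxx ?mul1r// => i /negPf ->.
by rewrite mul0r.
Qed.

(** Testing against [delta i] reads off the coordinates of [S g] and [S' g]. *)
Lemma adjoint_unique (T S S' : l2 R I -> l2 R I) :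
  is_adjoint T S -> is_adjoint T S' -> S = S'.
Proof.
move=> TS TS'; apply/funext => g; apply: l2P => i.
by apply: (inv_inj (@conjcK _)); rewrite -!inner_deltal -TS TS'.
Qed.

End Sums.

Lemma reindex_csum (R : realType) (I J : choiceType) (e : J -> I)
  (a : I -> R[i]) : bijective e -> csum a = csum (a \o e).
Proof.
move=> be; have be' : set_bij [set: J] [set: I] e.
  by rewrite setTT_bijective.
have rsumE (b : I -> R) : rsum b = rsum (b \o e).
  rewrite /rsum !(reindex_esum _ _ _ _ be'); congr (fine (_ - _)).
    by apply: eq_esum => i _; rewrite !funeposE.
  by apply: eq_esum => i _; rewrite !funenegE.
by rewrite /csum !(rsumE (fun i => _ (a i))).
Qed.

(** * Weighted permutations of the basis *)

Lemma conjC_inv (R : realType) (z : R[i]) : `|z| = 1 -> z^*%C = z^-1.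
Proof. by move=> z1; rewrite invc_norm z1 expr1n invr1 mul1r. Qed.

Lemma norm1_neq0 (R : numDomainType) (z : R) : `|z| = 1 -> z != 0.
Proof. by move=> z1; rewrite -normr_eq0 z1 oner_eq0. Qed.

Section WeightedPerm.
Variables (R : realType) (I J : choiceType) (e : J -> I) (w : J -> R[i]).
Hypotheses (e_bij : bijective e) (w_norm : forall j, `|w j| = 1).

Lemma sqnorm_wperm (f : I -> R[i]) : sqnorm (fun j => w j * f (e j)) = sqnorm f.
Proof.
have be : set_bij [set: J] [set: I] e by rewrite setTT_bijective.
rewrite /sqnorm [RHS](reindex_esum _ _ _ _ be); apply: eq_esum => j _.
by rewrite Normc.normcM normc1_norm// mul1r.
Qed.

Fact wperm_subproof (f : l2 R I) :
  (fun j => w j * f (e j)) \in @sqsummable R J.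
Proof.
by apply/asboolP; rewrite sqnorm_wperm; have /asboolP := l2valP f.
Qed.
(** The canonical unitaries, the right translations in the commutant and the unitary implementing
    the converse all have this form. *)
Definition wperm (f : l2 R I) : l2 R J := L2 (wperm_subproof f).

Lemma wpermE f j : wperm f j = w j * f (e j). Proof. by []. Qed.

Lemma l2norm_wperm f : l2norm (wperm f) = l2norm f.
Proof. by rewrite /l2norm sqnorm_wperm. Qed.

Lemma wperm_linear : linear wperm.
Proof.
by move=> c f g; apply: l2P => j; rewrite !(wpermE, l2D, l2Z) mulrDr mulrCA.
Qed.

Lemma inner_wperm f g : inner (wperm f) (wperm g) = inner f g.
Proof.
rewrite /inner [RHS](reindex_csum _ e_bij); apply: eq_csum => j /=.
by rewrite rmorphM mulrACA /= (conjC_inv (w_norm j)) divff ?mul1r ?norm1_neq0.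
Qed.

End WeightedPerm.

Lemma wperm_bounded (R : realType) (I : choiceType) (e : I -> I) (w : I -> R[i])
  (e_bij : bijective e) (w_norm : forall j, `|w j| = 1) :
  bounded_op (wperm e_bij w_norm).
Proof.
split; first exact: wperm_linear.
by exists 1 => f; rewrite l2norm_wperm mul1r.
Qed.

(** * Twisted group von Neumann algebras *)

Section Commutant.
Variables (R : realType) (I : choiceType).
Implicit Types (T S : l2 R I -> l2 R I) (X : set (l2 R I -> l2 R I)).

Lemma l2normZ_le (c : R[i]) (f : l2 R I) : l2norm (c *: f) <= normc c * l2norm f.
Proof.
apply: l2norm_le; first by rewrite mulr_ge0 ?l2norm_ge0 ?normc_ge0.
by apply: le_trans (le_sqnormZ _ _) _; rewrite exprMn [leRHS]EFinM l2norm_sqr.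
Qed.

Lemma bounded_comp T S : bounded_op T -> bounded_op S -> bounded_op (T \o S).
Proof.
move=> [lT [M MT]] [lS [L LS]]; split; first by move=> c f g /=; rewrite lS lT.
exists (Num.max M 0 * L) => f /=; apply: le_trans (MT _) _.
rewrite -mulrA; apply: (@le_trans _ _ (Num.max M 0 * l2norm (S f))).
  by rewrite ler_wpM2r ?l2norm_ge0// le_max lexx.
by rewrite ler_wpM2l// le_max lexx orbT.
Qed.

(** The factor 2 comes from the crude estimate [le_sqnormD]; it suffices to see that sums of bounded
    operators are bounded. *)
Lemma l2normD_le (f g : l2 R I) : l2norm (f + g) <= 2 * (l2norm f + l2norm g).
Proof.
have n0 := l2norm_ge0; apply: l2norm_le; first by rewrite mulr_ge0 ?addr_ge0 ?n0.
apply: le_trans (le_sqnormD f g) _; rewrite -!l2norm_sqr -!EFinD lee_fin.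
rewrite -subr_ge0; set a := l2norm f; set b := l2norm g.
have -> : (2 * (a + b)) ^+ 2 - (a ^+ 2 + b ^+ 2 + (a ^+ 2 + b ^+ 2)) =
  2 * (a ^+ 2 + b ^+ 2) + 8 * (a * b) by ring.
by rewrite addr_ge0 ?mulr_ge0 ?addr_ge0 ?sqr_ge0 ?n0.
Qed.

Lemma bounded_add T S : bounded_op T -> bounded_op S -> bounded_op (T + S).
Proof.
move=> [lT [M MT]] [lS [L LS]]; split.
  move=> c f g; rewrite -[LHS]/(T _ + S _) -[RHS]/(c *: (T f + S f) + (T g + S g)).
  by rewrite lT lS scalerDr addrACA.
exists (2 * (M + L)) => f; apply: le_trans (l2normD_le _ _) _.
by rewrite -mulrA ler_wpM2l// mulrDl lerD.
Qed.

Lemma bounded_scale (c : R[i]) T : bounded_op T -> bounded_op (c *: T).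
Proof.
move=> [lT [M MT]]; split.
  move=> d f g; rewrite -[LHS]/(c *: T _) -[RHS]/(d *: (c *: T _) + c *: T _).
  by rewrite lT scalerDr !scalerA mulrC.
exists (normc c * M) => f; apply: le_trans (l2normZ_le _ _) _.
by rewrite -mulrA ler_wpM2l ?normc_ge0.
Qed.

Lemma commutant_comp X T S :
  commutant X T -> commutant X S -> commutant X (T \o S).
Proof.
move=> [bT cT] [bS cS]; split; first exact: bounded_comp.
by move=> A XA; rewrite -compA cS// compA cT// compA.
Qed.

Lemma commutant_scale X (c : R[i]) T :
  X `<=` @bounded_op R I -> commutant X T -> commutant X (c *: T).
Proof.
move=> Xb [bT cT]; split; first exact: bounded_scale.
move=> A XA; apply/funext => f /=; have [lA _] := Xb _ XA.
rewrite -[LHS]/(c *: (T \o A) f) -[RHS]/(A (c *: T f)) cT//.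
by rewrite linearZ_op.
Qed.

Lemma commutant_bounded X : commutant X `<=` @bounded_op R I.
Proof. by move=> T []. Qed.

Lemma sub_vN_generated X : X `<=` @bounded_op R I -> X `<=` vN_generated X.
Proof.
move=> Xb A XA; split; first exact: Xb.
by move=> B [_ cB]; rewrite cB//; left.
Qed.

End Commutant.

Section TwistedAlgebra.
Variables (R : realType) (G : zmodType) (nu : cocycle R G).
Implicit Types (x y s t g : G) (T S : l2 R G -> l2 R G).
Local Notation u := (Defs.canonical nu).
Local Notation N := (twisted_vN nu).

Lemma cocycle_neq0 x y : nu x y != 0.
Proof. by apply: norm1_neq0; exact: cocycle_norm. Qed.

Lemma cocycleNg x : nu (- x) x = nu x (- x).
Proof.
have := cocycleP nu x (- x) x.
by rewrite subrr addNr cocycle0g cocycleg0 !mulr1 => ->.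
Qed.

Lemma subr_bij t : bijective (fun s : G => s - t).
Proof. by exists (fun s => s + t) => s; rewrite ?subrK ?addrK. Qed.

Lemma canonicalE x (f : l2 R G) s : u x f s = nu x (s - x) * f (s - x).
Proof. by []. Qed.

Lemma canonical_wperm x : u x =
  wperm (subr_bij x) (fun s => cocycle_norm nu x (s - x)).
Proof. by apply/funext => f; apply: l2P. Qed.

Lemma canonical_bounded x : bounded_op (u x).
Proof. by rewrite canonical_wperm; exact: wperm_bounded. Qed.

Lemma canonicalM x y : u x \o u y = nu x y *: u (x + y).
Proof.
apply/funext => f; apply: l2P => s.
rewrite -[RHS]/(nu x y * u (x + y) f s) /= opprD !addrA !mulrA; congr (_ * _).
have := cocycleP nu x y (s - x - y); rewrite addrCA subrr addr0 => ->.
by rewrite mulrC.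
Qed.

Lemma canonical0 : u 0 = id.
Proof.
by apply/funext => f; apply: l2P => s; rewrite canonicalE cocycle0g mul1r subr0.
Qed.

(** The inverse, and hence the adjoint, of the unitary u(x), because u(x) u(-x) is the scalar nu(x,
    -x). *)
Definition canonical_adj x : l2 R G -> l2 R G := (nu x (- x))^-1 *: u (- x).

Lemma canonicalK x : canonical_adj x \o u x = id.
Proof.
apply/funext => f /=; rewrite -[LHS]/(_ *: (u (- x) \o u x) f) canonicalM addNr.
rewrite canonical0 -[LHS]/(_ *: (_ *: f)) scalerA cocycleNg mulVf ?scale1r//.
exact: cocycle_neq0.
Qed.

Lemma canonicalKV x : u x \o canonical_adj x = id.
Proof.
apply/funext => f /=; rewrite /canonical_adj -[LHS]/(u x (_ *: _)).
rewrite linearZ_op; last by case: (canonical_bounded x).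
rewrite -[u x _]/((u x \o u (- x)) f) canonicalM subrr canonical0.
by rewrite -[_ (id : _ -> _)f]/(_ *: f) scalerA mulVf ?scale1r// cocycle_neq0.
Qed.

Lemma canonical_is_adjoint x : is_adjoint (u x) (canonical_adj x).
Proof.
move=> f g; rewrite -[g in LHS]/(id g) -(canonicalKV x) /=.
by rewrite canonical_wperm inner_wperm.
Qed.

Fact rtrans_norm t s : `|nu (s - t) t| = 1. Proof. exact: cocycle_norm. Qed.
(** The twisted right translation, sending delta_s to nu(s, t) delta_(s + t). By the cocycle
    identity it commutes with all u(x). *)
Definition rtrans t := wperm (subr_bij t) (rtrans_norm t).

Lemma rtransE t (f : l2 R G) s : rtrans t f s = nu (s - t) t * f (s - t).
Proof. by []. Qed.

Lemma rtrans_delta0 t : rtrans t (delta 0) = delta t.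
Proof.
apply: l2P => s; rewrite rtransE /= subr_eq0.
by case: eqVneq => [->|]; rewrite ?mulr0// subrr cocycle0g mulr1.
Qed.

Lemma rtrans_canonical t x : rtrans t \o u x = u x \o rtrans t.
Proof.
apply/funext => f; apply: l2P => s.
rewrite -[LHS]/(rtrans t (u x f) s) -[RHS]/(u x (rtrans t f) s).
rewrite rtransE !canonicalE rtransE !mulrA.
rewrite ![s - t - x]addrAC; congr (_ * _).
have := cocycleP nu x (s - x - t) t.
rewrite subrK (_ : x + (s - x - t) = s - t); last first.
  by rewrite addrA [x + _]addrC subrK.
by rewrite mulrC => ->; rewrite mulrC.
Qed.

Lemma adjoints_canonical S : adjoints (range u) S ->
  exists x, S = canonical_adj x.
Proof.
move=> [_ [_ [x _ <-]] xS]; exists x.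
exact: adjoint_unique xS (canonical_is_adjoint x).
Qed.

(** An operator commuting with u(x) commutes with its inverse, which is its adjoint. *)
Lemma rtrans_commutant t : commutant (range u `|` adjoints (range u)) (rtrans t).
Proof.
split; first exact: wperm_bounded.
move=> A [[x _ <-]|/adjoints_canonical[x ->]]; first exact: rtrans_canonical.
have K f : canonical_adj x (u x f) = f by have /(congr1 (@^~ f)) := canonicalK x.
have KV f : u x (canonical_adj x f) = f.
  by have /(congr1 (@^~ f)) := canonicalKV x.
apply/funext => f; rewrite -[LHS]K; congr (canonical_adj x _).
by have /(congr1 (@^~ (canonical_adj x f))) /= := rtrans_canonical t x; rewrite KV.
Qed.

Lemma twisted_vN_bounded : N `<=` @bounded_op R G.
Proof. exact: commutant_bounded. Qed.

Lemma twisted_vN_linear T : N T -> linear T.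
Proof. by case/twisted_vN_bounded. Qed.

Lemma canonical_vN x : N (u x).
Proof.
apply: sub_vN_generated; last by exists x.
by move=> _ [y _ <-]; exact: canonical_bounded.
Qed.

Lemma twisted_vN_comp T S : N T -> N S -> N (T \o S).
Proof. exact: commutant_comp. Qed.

Lemma twisted_vN_scale (c : R[i]) T : N T -> N (c *: T).
Proof. by apply: commutant_scale; exact: commutant_bounded. Qed.

Lemma canonical_adj_vN x : N (canonical_adj x).
Proof. by apply: twisted_vN_scale; exact: canonical_vN. Qed.

(** [delta t] is the image of [delta 0] under [rtrans t], which commutes with [T]. So the Fourier
    coefficients, the coordinates of [T (delta 0)], determine the whole matrix of [T]. *)
Lemma twisted_vN_delta T t s : N T ->
  T (delta t) s = nu (s - t) t * T (delta 0) (s - t).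
Proof.
move=> [_ cT]; rewrite -rtrans_delta0 -[T _]/((T \o rtrans t) (delta 0)).
by rewrite cT//; exact: rtrans_commutant.
Qed.

(** The bounded operator [T - S] has zero matrix by [twisted_vN_delta], and finite truncations show
    that it vanishes. *)
Lemma twisted_vN_separating T S : N T -> N S -> T (delta 0) = S (delta 0) ->
  T = S.
Proof.
move=> NT NS TS; apply/funext => f; apply: l2P => s.
have TSd t : T (delta t) s = S (delta t) s
  by rewrite (twisted_vN_delta t s NT) (twisted_vN_delta t s NS) TS.
apply/eqP; rewrite -subr_eq0; apply/eqP.
pose D : l2 R G -> l2 R G := T + -1 *: S.
have DE h : D h s = T h s - S h s by rewrite -mulN1r.
have bD : bounded_op D.
  by apply: bounded_add; last apply: bounded_scale; exact: twisted_vN_bounded.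
have Dd t : D (delta t) s = 0 by rewrite DE TSd subrr.
rewrite -DE (@bounded_op_coord _ _ D f s 0 bD) ?Dd ?mulr0// => t _.
by rewrite Dd mulr0.
Qed.

(** The trace recovers the Fourier coefficients up to phases, so trace preserving maps control
    them. *)
Lemma trace_canonical_comp T s : trace (u (- s) \o T) = nu (- s) s * T (delta 0) s.
Proof. by rewrite /trace inner_delta /= sub0r opprK. Qed.

End TwistedAlgebra.

(** * The plane *)

Definition vec2 (a b : int) : Z2 := \col_i if i == 0 then a else b.
Definition mx22 (a b c d : int) : 'M[int]_2 :=
  \matrix_(i, j) if i == 0 then if j == 0 then a else b
                 else if j == 0 then c else d.

Lemma Z2P (v w : Z2) : v 0 0 = w 0 0 -> v 1 0 = w 1 0 -> v = w.
Proof.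
move=> vw0 vw1; apply/matrixP => i j; rewrite ord1.
by case: i => [[|[|//]] lti]; [move: vw0|move: vw1];
  congr (v _ _ = w _ _); apply: val_inj.
Qed.

Lemma Z2D (v w : Z2) i : (v + w) i 0 = v i 0 + w i 0.
Proof. by rewrite mxE. Qed.

Lemma vec2_0 a b : vec2 a b 0 0 = a. Proof. by rewrite mxE. Qed.
Lemma vec2_1 a b : vec2 a b 1 0 = b. Proof. by rewrite mxE. Qed.

Lemma mx22_mul0 a b c d (v : Z2) :
  (mx22 a b c d *m v) 0 0 = a * v 0 0 + b * v 1 0.
Proof.
rewrite mxE !big_ord_recl big_ord0 !mxE addr0.
by have -> : lift ord0 ord0 = 1 :> 'I_2 by exact: val_inj.
Qed.
Lemma mx22_mul1 a b c d (v : Z2) :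
  (mx22 a b c d *m v) 1 0 = c * v 0 0 + d * v 1 0.
Proof.
rewrite mxE !big_ord_recl big_ord0 !mxE addr0.
by have -> : lift ord0 ord0 = 1 :> 'I_2 by exact: val_inj.
Qed.

Lemma mx22_eta (g : 'M[int]_2) : g = mx22 (g 0 0) (g 0 1) (g 1 0) (g 1 1).
Proof.
apply/matrixP => i j; rewrite mxE.
by case: i => [[|[|//]] lti]; case: j => [[|[|//]] ltj] /=;
  congr (g _ _); apply: val_inj.
Qed.

Lemma det_mx22 a b c d : \det (mx22 a b c d) = a * d - b * c.
Proof.
rewrite (expand_det_row _ 0) !big_ord_recl big_ord0 /cofactor !det_mx11 !mxE /=.
by rewrite expr0 expr1 addr0 mul1r mulN1r mulrN.
Qed.

Fact sl2_subproof a b c d : a * d - b * c = 1 -> \det (mx22 a b c d) == 1.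
Proof. by rewrite det_mx22 => ->. Qed.
Definition sl2 a b c d (abcd : a * d - b * c = 1) := SL2ZMx (sl2_subproof abcd).

Definition unipotent (n : int) : SL2Z := @sl2 1 n 0 1 (ltac:(by rewrite mulr0 subr0)).
Definition rotation : SL2Z := @sl2 0 (-1) 1 0 erefl.
(** Followed by the translation by [e1], this matrix of order three permutes [0], [e1], [e2]
    cyclically. *)
Definition cyclic3 : SL2Z := @sl2 (-1) (-1) 1 0 erefl.
Definition minus_one : SL2Z := @sl2 (-1) 0 0 (-1) erefl.

Definition e1 := vec2 1 0.
Definition e2 := vec2 0 1.

Definition Z2E := (mx22_mul0, mx22_mul1, vec2_0, vec2_1).

Lemma aff_actE0 (k : Z2) (g : SL2Z) m : aff_act (Aff k g) m = k + g *m m.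
Proof. by []. Qed.

Lemma aff_mulE (k : Z2) (g : SL2Z) : Aff k g = (Aff k 1 * Aff 0 g)%g.
Proof.
by rewrite -[RHS]/(Aff (k + 1%:M *m 0) (1 * g)%g) mulmx0 addr0 mul1g.
Qed.

(** * Elements of Lambda(H) and products over the plane *)

Section LambdaFacts.
Variable H : zmodType.
Implicit Types (x y : Lambda H) (k l m : Z2) (h : H).

Lemma LamP x y : (forall m, x m = y m) -> x = y.
Proof. by move=> xy; apply: val_inj; apply/funext. Qed.
Lemma LamD x y m : (x + y) m = x m + y m. Proof. by []. Qed.
Lemma LamN x m : (- x) m = - x m. Proof. by []. Qed.
Lemma LamB x y m : (x - y) m = x m - y m. Proof. by []. Qed.
Lemma Lam0 m : (0 : Lambda H) m = 0. Proof. by []. Qed.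
Lemma Lam_sum (J : Type) (r : seq J) (F : J -> Lambda H) m :
  (\sum_(j <- r) F j) m = \sum_(j <- r) F j m.
Proof. by elim/big_rec2: _ => // j x y _ <-; rewrite LamD. Qed.

Definition supp x : {fset Z2} := fset_set [set k | x k != 0].

Lemma notin_supp x k : k \notin supp x -> x k = 0.
Proof.
rewrite in_fset_set; last exact: Lambda_finite.
by rewrite notin_setE /= => /negP; rewrite negbK => /eqP.
Qed.

Lemma Lam_sum0 x (A : {fset Z2}) : (forall k, k \notin A -> x k = 0) ->
  \sum_(k <- A) x k = 0.
Proof.
by move=> xA; rewrite -fsbigTE//; have /asboolP[] := LambdaP x.
Qed.

Fact lpair_subproof k l h :
  (fun m => h *+ (m == k) - h *+ (m == l)) \in @lambda_pred H.
Proof.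
have fin k' : finite_set [set m | h *+ (m == k') != 0].
  apply: (@sub_finite_set _ _ [set k']); last exact: finite_set1.
  by move=> m /=; apply: contraNP => /eqP/negPf ->; rewrite mulr0n.
have sum k' : \sum_(m \in [set: Z2]) h *+ (m == k') = h.
  rewrite (fsbigTE [fset k']%fset) ?big_seq_fset1 ?eqxx ?mulr1n// => i.
  by rewrite in_fset1 => /negPf ->; rewrite mulr0n.
apply/asboolP; split; last by rewrite fsum_sub// !sum subrr.
apply: (@sub_finite_set _ _ [set k; l]); last exact: finite_set2.
move=> m /=; apply: contraNP => /not_orP[/eqP/negPf -> /eqP/negPf ->].
by rewrite !mulr0n subr0.
Qed.
(** For k = l the two terms cancel, so that [lpair_trans] holds for all triples of points. *)
Definition lpair k l h := MkLambda (lpair_subproof k l h).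

Lemma lpairE k l h m : lpair k l h m = h *+ (m == k) - h *+ (m == l).
Proof. by []. Qed.

Lemma lpairD k l g h : lpair k l (g + h) = lpair k l g + lpair k l h.
Proof. by apply: LamP => m; rewrite LamD !lpairE !mulrnDl opprD addrACA. Qed.

Lemma lpairN k l h : lpair k l (- h) = - lpair k l h.
Proof. by apply: LamP => m; rewrite LamN !lpairE !mulNrn opprK opprB addrC. Qed.

Lemma lpairC k l h : lpair k l h = - lpair l k h.
Proof. by apply: LamP => m; rewrite LamN !lpairE opprB. Qed.

Lemma lpair_trans k l m h : lpair k l h + lpair l m h = lpair k m h.
Proof. by apply: LamP => n; rewrite LamD !lpairE addrA subrK. Qed.

Lemma lpairl k l h : k != l -> lpair k l h k = h.
Proof. by move=> /negPf kl; rewrite lpairE eqxx kl subr0. Qed.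

Lemma lpairkk k h : lpair k k h = 0.
Proof. by apply: LamP => m; rewrite lpairE subrr. Qed.

Lemma Lambda_supp1 x k : (forall m, m != k -> x m = 0) -> x = 0.
Proof.
move=> xk; apply: LamP => m; rewrite Lam0.
have [->|/xk//] := eqVneq m k.
rewrite -(@Lam_sum0 x [fset k]%fset) ?big_seq_fset1// => l.
by rewrite in_fset1; exact: xk.
Qed.

(** The difference of the two sides is carried by [l] alone, and its values sum to zero. *)
Lemma Lambda_supp2 x k l : k != l ->
  (forall m, m != k -> m != l -> x m = 0) -> x = lpair k l (x k).
Proof.
move=> kl xkl; apply/eqP; rewrite -subr_eq0; apply/eqP.
apply: (@Lambda_supp1 _ l) => m ml; rewrite LamB lpairE (negPf ml) subr0.
have [->|mk] := eqVneq m k; first by rewrite subrr.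
by rewrite xkl// subr0.
Qed.

(** The negative terms at the origin add up to minus the total sum of [x], which is zero. *)
Lemma Lambda_decomp x : x = \sum_(m <- supp x) lpair m 0 (x m).
Proof.
apply: LamP => k; rewrite Lam_sum.
under eq_bigr do rewrite lpairE.
rewrite sumrB [X in _ - X](_ : _ = 0) ?subr0; last first.
  by rewrite sumrMnl (Lam_sum0 (@notin_supp x)) mul0rn.
have [kx|kx] := boolP (k \in supp x); last first.
  rewrite notin_supp// big1_seq// => i /andP[_ ix].
  by case: eqVneq => [ki|]; rewrite ?mulr0n// -ki (negPf kx) in ix *.
rewrite (big_fsetD1 k)//= eqxx mulr1n big1_seq ?addr0// => i.
by rewrite !inE eq_sym => /and3P[_ /negPf -> _]; rewrite mulr0n.
Qed.

Lemma Lambda_actE g x m : Lambda_act g x m = x (aff_act g^-1%g m).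
Proof. by []. Qed.

Lemma Lambda_act_at g x m : Lambda_act g x (aff_act g m) = x m.
Proof. by rewrite Lambda_actE aff_actK. Qed.

Lemma Lambda_act1 x : Lambda_act 1%g x = x.
Proof. by apply: LamP => m; rewrite Lambda_actE invg1 aff_act1. Qed.

Lemma Lambda_actM g g' x : Lambda_act (g * g')%g x = Lambda_act g (Lambda_act g' x).
Proof. by apply: LamP => m; rewrite !Lambda_actE invgM aff_actM. Qed.

Lemma Lambda_actKV g : cancel (@Lambda_act H g^-1%g) (Lambda_act g).
Proof. by move=> x; rewrite -Lambda_actM mulgV Lambda_act1. Qed.

Lemma Lambda_actN g x : Lambda_act g (- x) = - Lambda_act g x.
Proof. exact: LamP. Qed.

Lemma Lambda_act_pair g k l h :
  Lambda_act g (lpair k l h) = lpair (aff_act g k) (aff_act g l) h.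
Proof.
apply: LamP => m; rewrite Lambda_actE !lpairE.
have eqg n : (aff_act g^-1%g m == n) = (m == aff_act g n).
  by apply/eqP/eqP => [<-|->]; rewrite ?aff_actK ?aff_actKV.
by rewrite !eqg.
Qed.

End LambdaFacts.

Section FinProd.
Variable (R : realType).
Implicit Types (f g : Z2 -> R[i]).
Local Notation "\fprod_ k F" := (\big[*%R/1]_(k \in [set: Z2]) F)
  (at level 36, k at level 8, F at level 36).

Lemma fprod_norm f : (forall k, `|f k| = 1) -> `|\fprod_k f k| = 1.
Proof. by move=> f1; rewrite normr_prod big1. Qed.

Lemma fprodM (A : {fset Z2}) f g : (forall k, k \notin A -> f k = 1) ->
  (forall k, k \notin A -> g k = 1) ->
  \fprod_k (f k * g k) = (\fprod_k f k) * (\fprod_k g k).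
Proof.
move=> fA gA; rewrite !(fsbigTE A)//; first by rewrite big_split.
by move=> k kA; rewrite fA// gA// mulr1.
Qed.

Lemma fprod_act (g : affine) f : \fprod_k f k = \fprod_k f (aff_act g k).
Proof.
apply: (reindex_fsbigT (aff_act g)).
by exists (aff_act g^-1%g); [exact: aff_actK|exact: aff_actKV].
Qed.

Lemma eq_fprod f g : f =1 g -> \fprod_k f k = \fprod_k g k.
Proof. by move=> /funext ->. Qed.

Lemma fprod1 : \fprod_k (1 : R[i]) = 1.
Proof. by rewrite fsbig1. Qed.

Variable H : zmodType.

Lemma character0 (chi : character R H) : chi 0 = 1.
Proof.
have := characterD chi 0 0; rewrite addr0 => /esym/eqP.
rewrite -subr_eq0 -[X in _ - X]mulr1 -mulrBr mulf_eq0 subr_eq0.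
by rewrite (negPf (norm1_neq0 (character_norm chi 0))) => /eqP.
Qed.

Lemma character_sum (chi : character R H) (J : Type) (r : seq J) (F : J -> H) :
  chi (\sum_(j <- r) F j) = \prod_(j <- r) chi (F j).
Proof. by elim/big_rec2: _ => [|j x y _ <-]; rewrite ?character0 ?characterD. Qed.

(** The product is the value of [chi] at the total sum of [x]. *)
Lemma fprod_character (chi : character R H) (x : Lambda H) :
  \fprod_k chi (x k) = 1.
Proof.
rewrite (fsbigTE (supp x)).
  by rewrite -character_sum (Lam_sum0 (@notin_supp _ x)) character0.
by move=> k /notin_supp ->; rewrite character0.
Qed.

End FinProd.

(** * Twisted Bernoulli shifts *)

Lemma opZE (R : realType) (I J : choiceType) (c : R[i]) (T : l2 R I -> l2 R J) f :
  (c *: T) f = c *: T f.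
Proof. by []. Qed.

Lemma coef_congr (R : realType) (I : choiceType) (T S : l2 R I -> l2 R I) f i :
  T = S -> T f i = S f i.
Proof. by move=> ->. Qed.

Lemma norm_exprz (R : realType) (z : R[i]) (n : int) : `|z| = 1 -> `|z ^ n| = 1.
Proof.
by case: n => n z1; rewrite /exprz ?normfV normrX z1 expr1n ?invr1.
Qed.

(** * Star isomorphisms of operator algebras *)

Section StarIso.
Variables (R : realType) (I J : choiceType).
Variables (M : set (l2 R I -> l2 R I)) (N : set (l2 R J -> l2 R J)).
Variable pi : (l2 R I -> l2 R I) -> (l2 R J -> l2 R J).
Hypothesis pi_iso : star_isomorphism M N pi.

Lemma iso_mem x : M x -> N (pi x).
Proof. by case: pi_iso => -[+ _ _ _ _ _ _] => /[apply]. Qed.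

Lemma iso_inj x y : M x -> M y -> pi x = pi y -> x = y.
Proof.
by case: pi_iso => -[_ + _ _ _ _ _] => pi_inj Mx My; apply: pi_inj; rewrite inE.
Qed.

Lemma iso_surj y : N y -> exists2 x, M x & pi x = y.
Proof. by case: pi_iso => -[_ _ + _ _ _ _] => /[apply]. Qed.

Lemma isoZ c x : M x -> pi (c *: x) = c *: pi x.
Proof. by case: pi_iso => _ _ + _ _; apply. Qed.

Lemma iso_comp x y : M x -> M y -> pi (x \o y) = pi x \o pi y.
Proof. by case: pi_iso => _ _ _ + _; apply. Qed.

Lemma iso_adjoint x y : M x -> M y -> is_adjoint x y -> is_adjoint (pi x) (pi y).
Proof. by case: pi_iso => _ _ _ _; apply. Qed.

(** If [pi x = id], then multiplicativity on [id \o x] reads [id = pi id]. *)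
Lemma iso_id : M id -> N id -> pi id = id.
Proof.
move=> Mid /iso_surj[x Mx pix]; have := iso_comp Mid Mx.
by rewrite pix.
Qed.

End StarIso.

(** * Fourier coefficients under a twisted Bernoulli shift *)

Section Bernoulli.
Variables (R : realType) (H : zmodType) (mu : cocycle R H).
Local Notation N := (N_vN mu).
Local Notation u := (N_unitary mu).
Local Notation nu := (mu_tilde mu).

Lemma u_vN x : N (u x). Proof. exact: canonical_vN. Qed.

Lemma u0 : u 0 = id. Proof. exact: canonical0. Qed.

Lemma id_vN : N id. Proof. by rewrite -u0; exact: u_vN. Qed.

Lemma u_delta0 x : u x (delta 0) = delta x.
Proof. by rewrite /u canonical_delta cocycleg0 scale1r addr0. Qed.

(** Evaluation at [delta 0] turns the unitaries into distinct basis vectors. *)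
Lemma u_scale_inj (c d : R[i]) x y : c != 0 ->
  c *: u x = d *: u y -> x = y /\ c = d.
Proof.
move=> c0 /coef_congr - /(_ (delta 0) x).
rewrite !opZE !l2Z !u_delta0 /= eqxx mulr1.
have [->|_ cd] := eqVneq x y; first by rewrite mulr1.
by rewrite cd mulr0 eqxx in c0.
Qed.

Variables (chi : character R H).
Variable beta : affine -> (l2 R (Lambda H) -> l2 R (Lambda H)) ->
                (l2 R (Lambda H) -> l2 R (Lambda H)).
Hypothesis betaP : twisted_bernoulli mu chi beta.

Lemma twist_norm k x : `|twist chi k x| = 1.
Proof.
by apply: fprod_norm => m; rewrite norm_exprz ?character_norm.
Qed.

Lemma beta_iso g : star_isomorphism N N (beta g).
Proof. by case: betaP. Qed.

Lemma beta_vN g x : N x -> N (beta g x).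
Proof. by move=> Nx; exact: (iso_mem (beta_iso g) Nx). Qed.

Lemma beta_u k (gamma : SL2Z) x : beta (Aff k gamma) (u x) =
  twist chi k (Lambda_act (Aff 0 gamma) x) *: u (Lambda_act (Aff k gamma) x).
Proof.
case: betaP => _ _ [_ betaM] betaS betaT.
rewrite aff_mulE betaM; last exact: u_vN.
by rewrite betaS betaT -Lambda_actM.
Qed.

Lemma beta_u_norm g x : exists2 c : R[i], `|c| = 1 &
  beta g (u x) = c *: u (Lambda_act g x).
Proof.
case: g => k gamma; exists (twist chi k (Lambda_act (Aff 0 gamma) x)).
  exact: twist_norm.
exact: beta_u.
Qed.

(** [beta g] preserves the trace of u(-s) x and sends u(-s) to a phase times u(-gs). Hence it moves
    the coefficient at s to gs, up to a phase. *)
Lemma normc_coef_beta g x s : N x ->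
  normc (beta g x (delta 0) (Lambda_act g s)) = normc (x (delta 0) s).
Proof.
move=> Nx; case: (betaP) => _ tr _ _ _.
have := tr g _ (twisted_vN_comp (u_vN (- s)) Nx).
rewrite (iso_comp (beta_iso g))//; last exact: u_vN.
have [c c1 ->] := beta_u_norm g (- s); rewrite Lambda_actN.
rewrite trace_canonical_comp -[X in trace X]/(c *: (u _ \o beta g x)).
have traceZ T : trace (c *: T) = c * trace T.
  by rewrite /trace !inner_delta.
rewrite traceZ trace_canonical_comp => /(congr1 (@Normc.normc R)).
rewrite !Normc.normcM (normc1_norm c1) !(normc1_norm (cocycle_norm _ _ _)).
by rewrite !mul1r.
Qed.

(* The orbit of a coefficient under the unipotents is constant in modulus, so
   square summability forces a finite orbit. *)
Lemma fixed_unipotent_supp x s m : N x ->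
  (forall n : nat, beta (Aff 0 (unipotent n%:Z)) x = x) ->
  x (delta 0) s != 0 -> s m != 0 -> m 1 0 = 0.
Proof.
move=> Nx fixx xs sm; apply: contrapT => /eqP m1.
pose f (n : nat) := Lambda_act (Aff 0 (unipotent n%:Z)) s.
have xf n : normc (x (delta 0) (f n)) = normc (x (delta 0) s).
  by rewrite -{1}(fixx n) normc_coef_beta.
have e0 : 0 < normc (x (delta 0) s).
  rewrite lt_neqAle normc_ge0 andbT eq_sym; apply: contra xs => /eqP.
  by move/Normc.eq0_normc => ->.
have finL := finite_level_set (x (delta 0)) e0.
set L := [set _ | _] in finL.
(* The orbit of [m] stays in the supports of the finitely many functions in [L]. *)
pose S := \bigcup_(t in L) [set k | t k != 0].
have finS : finite_set S.
  by apply: bigcup_finite => // t _; exact: Lambda_finite.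
pose h (n : nat) : Z2 := aff_act (Aff 0 (unipotent n%:Z)) m.
have hS : h @` [set: nat] `<=` S.
  move=> _ [n _ <-]; exists (f n); first by rewrite /L /= xf.
  suff : f n (h n) != 0 by [].
  by rewrite /f /h Lambda_act_at.
(* The first coordinate of [h n] is [m 0 0 + n * m 1 0], with [m 1 0] nonzero. *)
have hinj : injective h.
  move=> n n' /(congr1 (fun v : Z2 => v 0 0)).
  rewrite /h !aff_actE0 !add0r /= !mx22_mul0 => /addrI.
  by move/(mulIf m1) => [].
apply: infinite_nat; have := sub_finite_set hS finS.
by rewrite (eq_finite_set (inj_card_eq (in2W hinj))).
Qed.

End Bernoulli.

(** * Equivariant isomorphisms on two-point functions *)

Lemma e01 : (0 : Z2) != e1.
Proof. by apply/eqP => /(congr1 (fun v : Z2 => v 0 0)); rewrite !mxE. Qed.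

Lemma e12 : e1 != e2.
Proof. by apply/eqP => /(congr1 (fun v : Z2 => v 0 0)); rewrite !mxE. Qed.

Section Equivariant.
Variables (R : realType) (Ha Hb : zmodType).
Variables (mua : cocycle R Ha) (mub : cocycle R Hb).
Variables (chia : character R Ha) (chib : character R Hb).
Variable betaa : affine -> (l2 R (Lambda Ha) -> l2 R (Lambda Ha)) ->
                (l2 R (Lambda Ha) -> l2 R (Lambda Ha)).
Variable betab : affine -> (l2 R (Lambda Hb) -> l2 R (Lambda Hb)) ->
                (l2 R (Lambda Hb) -> l2 R (Lambda Hb)).
Hypothesis betaaP : twisted_bernoulli mua chia betaa.
Hypothesis betabP : twisted_bernoulli mub chib betab.
Variable pi : (l2 R (Lambda Ha) -> l2 R (Lambda Ha)) ->
              (l2 R (Lambda Hb) -> l2 R (Lambda Hb)).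
(** The assumptions on [pi] are spelled out one by one so that they can also be verified for an
    inverse of a given isomorphism. *)
Hypothesis pi_mem : forall x, N_vN mua x -> N_vN mub (pi x).
Hypothesis piZ : forall c x, N_vN mua x -> pi (c *: x) = c *: pi x.
Hypothesis pi_comp : forall x y, N_vN mua x -> N_vN mua y ->
  pi (x \o y) = pi x \o pi y.
Hypothesis pi_id : pi id = id.
Hypothesis pi_conj : conjugates mua betaa betab pi.
Local Notation u := (N_unitary mua).
Local Notation v := (N_unitary mub).

Lemma pi_u_act g x : exists2 c : R[i], `|c| = 1 &
  pi (u (Lambda_act g x)) = c *: betab g (pi (u x)).
Proof.
have [c c1 cE] := beta_u_norm betaaP g x.
exists c^-1; first by rewrite normrV ?c1 ?invr1// unitfE norm1_neq0.
rewrite -pi_conj; last exact: u_vN.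
rewrite cE piZ; last exact: u_vN.
by rewrite scalerA mulVf ?scale1r// norm1_neq0.
Qed.

(** Up to a phase, [betab g^-1] moves the image back to that of [u (lpair 0 e1 h)]. This one is
    fixed by the unipotents, so [fixed_unipotent_supp] puts its coefficients on the axis through
    [e1]. *)
Lemma pi_u_supp g h s m :
  pi (u (lpair (aff_act g 0) (aff_act g e1) h)) (delta 0) s != 0 -> s m != 0 ->
  exists2 m', m = aff_act g m' & m' 1 0 = 0.
Proof.
move=> xs sm; exists (aff_act g^-1%g m); first by rewrite aff_actKV.
move: xs; rewrite -Lambda_act_pair; have [c c1 ->] := pi_u_act g (lpair 0 e1 h).
set x := pi _; have Nx : N_vN mub x by apply/pi_mem/u_vN.
rewrite opZE l2Z mulf_eq0.
rewrite (negPf (norm1_neq0 c1)) /= -[s](Lambda_actKV g) => xs.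
apply: (fixed_unipotent_supp betabP Nx (s := Lambda_act g^-1%g s)).
- move=> n; rewrite /x -pi_conj; last exact: u_vN.
  rewrite (beta_u betaaP) Lambda_act_pair.
  have e0 : aff_act (Aff 0 (unipotent n%:Z)) 0 = 0.
    by rewrite aff_actE0 add0r mulmx0.
  have e1' : aff_act (Aff 0 (unipotent n%:Z)) e1 = e1.
    by rewrite aff_actE0 add0r; apply: Z2P; rewrite !Z2E; ring.
  rewrite e0 e1' (_ : twist _ _ _ = 1) ?scale1r//.
  rewrite /twist (eq_fprod (g := fun=> 1)) ?fprod1// => k.
  by rewrite /det2 !mxE !mul0r subr0.
- apply: contra xs => /eqP xs0; apply/eqP/Normc.eq0_normc.
  by rewrite (normc_coef_beta betabP) ?xs0 ?Normc.normc0.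
- by rewrite Lambda_actE invgK aff_actKV.
Qed.

(** [u x] has a left inverse in the algebra, so its image cannot kill [delta 0]. *)
Lemma pi_u_neq0 x : exists s, pi (u x) (delta 0) s != 0.
Proof.
apply: contrapT => nex.
have pix0 : pi (u x) (delta 0) = 0.
  by apply: l2P => s; apply: contrapT => /eqP ?; apply: nex; exists s.
have Nadj := canonical_adj_vN (mu_tilde mua) x.
have := pi_comp Nadj (u_vN mua x).
rewrite canonicalK pi_id => /coef_congr - /(_ (delta 0) 0).
rewrite /= pix0 -[X in pi _ X](scale0r 0) linearZ_op ?scale0r; last first.
  by apply: twisted_vN_linear (pi_mem Nadj).
by rewrite eqxx => /eqP; rewrite oner_eq0.
Qed.

Lemma line01 h s m : pi (u (lpair 0 e1 h)) (delta 0) s != 0 -> s m != 0 ->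
  m 1 0 = 0.
Proof.
move=> xs sm; have := @pi_u_supp 1%g h s m; rewrite !aff_act1.
by case=> // m' ->; rewrite aff_act1.
Qed.

(** The affine map [Aff e1 cyclic3] carries the side from [0] to [e1] onto the side from [e1] to
    [e2]. *)
Lemma line12 h s m : pi (u (lpair e1 e2 h)) (delta 0) s != 0 -> s m != 0 ->
  m 0 0 + m 1 0 = 1.
Proof.
move=> xs sm; have := @pi_u_supp (Aff e1 cyclic3) h s m.
have -> : aff_act (Aff e1 cyclic3) 0 = e1 by rewrite aff_actE0 mulmx0 addr0.
have -> : aff_act (Aff e1 cyclic3) e1 = e2.
  by rewrite aff_actE0; apply: Z2P; rewrite Z2D !Z2E.
case=> // m' -> m'0; rewrite aff_actE0 !Z2D !Z2E m'0.
by ring.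
Qed.

Lemma line02 h s m : pi (u (lpair 0 e2 h)) (delta 0) s != 0 -> s m != 0 ->
  m 0 0 = 0.
Proof.
move=> xs sm; have := @pi_u_supp (Aff 0 rotation) h s m.
have -> : aff_act (Aff 0 rotation) 0 = 0 by rewrite aff_actE0 mulmx0 addr0.
have -> : aff_act (Aff 0 rotation) e1 = e2.
  by rewrite aff_actE0 add0r; apply: Z2P; rewrite !Z2E.
case=> // m' -> m'0; rewrite aff_actE0 add0r Z2E m'0.
by ring.
Qed.

(* [u(h d_0 - h d_e1) u(h d_e1 - h d_e2)] is proportional to
   [u(h d_0 - h d_e2)]; the three images are carried by the three sides of a
   triangle, whose lines meet only at its vertices. *)
Lemma pi_u_pair h : exists c h', pi (u (lpair 0 e1 h)) = c *: v (lpair 0 e1 h').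
Proof.
set x := pi _; set y := pi (u (lpair e1 e2 h)); set w := pi (u (lpair 0 e2 h)).
have Nx : N_vN mub x by apply/pi_mem/u_vN.
have Ny : N_vN mub y by apply/pi_mem/u_vN.
have [t yt] : exists t, y (delta 0) t != 0 by exact: pi_u_neq0.
have xyw : x \o y = mu_tilde mua (lpair 0 e1 h) (lpair e1 e2 h) *: w.
  rewrite -pi_comp; try exact: u_vN.
  rewrite canonicalM lpair_trans piZ //; exact: u_vN.
have ws s : x (delta 0) s != 0 -> w (delta 0) (s + t) != 0.
  move=> xs.
  (* No cancellation occurs: if [r] contributes too, then [r - t] is carried by the lines of both
     [x] and [y], hence by [e1] alone, and so it is zero. *)
  have xyst : (x \o y) (delta 0) (s + t) =
      y (delta 0) t * x (delta t) (s + t).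
    apply: (@bounded_op_coord _ _ x (y (delta 0)) (s + t) t).
      exact: twisted_vN_bounded Nx.
    move=> r rt; apply/eqP; apply: contraNT rt; rewrite mulf_eq0 negb_or.
    case/andP => yr; rewrite (twisted_vN_delta _ _ Nx) mulf_eq0 negb_or.
    case/andP => _ xr; rewrite -subr_eq0; apply/eqP.
    apply: (@Lambda_supp1 _ _ e1) => m me1; apply/eqP; apply: contraNT me1 => rm.
    have m12 : m 0 0 + m 1 0 = 1.
      have [tm|tm] := eqVneq (t m) 0; last exact: line12 yt tm.
      by apply: line12 yr _; rewrite LamB tm subr0 in rm.
    have m01 : m 1 0 = 0.
      have [sm|sm] := eqVneq (s m) 0; last exact: line01 xs sm.
      apply: line01 xr _; rewrite LamB LamD sm add0r.
      by rewrite -oppr_eq0 opprB.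
    apply/eqP; apply: Z2P; rewrite !Z2E //.
    by rewrite m01 addr0 in m12.
  have : (x \o y) (delta 0) (s + t) != 0.
    rewrite xyst mulf_neq0// (twisted_vN_delta _ _ Nx) mulf_neq0 ?addrK//.
    exact: cocycle_neq0.
  rewrite xyw; apply: contra => /eqP ws0.
  by rewrite opZE l2Z ws0 mulr0.
have xsupp s : x (delta 0) s != 0 -> s = lpair 0 e1 (t e1).
  move=> xs; have wst := ws s xs.
  (* On the line of [x], away from [e1], the function [t] vanishes and [s] agrees with [s + t],
     which lives on the line of [w]. The two lines meet at [0]. *)
  have sE : s = lpair 0 e1 (s 0).
    apply: Lambda_supp2 e01 _ => m m0 me1.
    apply/eqP; apply: contraNT m0 => sm; have m10 := line01 xs sm.
    have tm : t m = 0.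
      apply/eqP; apply: contraNT me1 => /(line12 yt); rewrite m10 addr0 => m00.
      by apply/eqP; apply: Z2P; rewrite !Z2E.
    have /(line02 wst) m00 : (s + t) m != 0 by rewrite LamD tm addr0.
    by apply/eqP; apply: Z2P; rewrite !mxE.
  (* The point [e1] is off the line of [w]. Thus [s] takes the value [- t e1] there, and the fixed
     function [t] determines [s]. *)
  have : (s + t) e1 = 0.
    apply/eqP; apply: contraT => /(line02 wst); rewrite Z2E => /eqP.
    by rewrite oner_eq0.
  rewrite LamD {1}sE lpairE eq_sym (negPf e01) eqxx sub0r mulr1n.
  by rewrite addrC => /eqP; rewrite subr_eq0 => /eqP ->.
exists (x (delta 0) (lpair 0 e1 (t e1))), (t e1).
apply: (twisted_vN_separating Nx); first by apply/twisted_vN_scale/u_vN.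
rewrite opZE u_delta0; apply: l2P => s.
rewrite l2Z /=; case: eqVneq => [->|/eqP ns]; first by rewrite mulr1.
by rewrite mulr0; apply: contrapT => /eqP /xsupp.
Qed.

End Equivariant.

(** * Symmetric circle-valued cocycles are coboundaries *)

Section DivisibleComplement.
Variables (A : zmodType) (D : set A).
Hypothesis D_sub : forall x y, D x -> D y -> D (x - y).
Hypothesis D0 : D 0.
Hypothesis D_div : forall n x, (0 < n)%N -> D x -> exists2 y, D y & y *+ n = x.

Let sub_closed (K : set A) := forall x y, K x -> K y -> K (x - y).

Lemma sub_closed_mulrz (K : set A) x (n : int) : sub_closed K -> K 0 -> K x ->
  K (x *~ n).
Proof.
move=> Ks K0 Kx.
have KN y : K y -> K (- y) by move=> Ky; rewrite -sub0r; exact: Ks.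
have Kn (m : nat) : K (x *+ m).
  elim: m => [//|m IH]; rewrite mulrSr -[X in _ + X]opprK.
  by apply: Ks => //; exact: KN.
by case: n => n; [exact: Kn|rewrite NegzE mulrNz; apply: KN; exact: Kn].
Qed.

Let sumD (K : set A) x := exists k d, [/\ K k, D d & x = k + d].

Lemma sumD_sub_closed K : sub_closed K -> sub_closed (sumD K).
Proof.
move=> Ks _ _ [k [d [Kk Dd ->]]] [k' [d' [Kk' Dd' ->]]].
exists (k - k'), (d - d'); split; [exact: Ks|exact: D_sub|].
by rewrite opprD addrACA.
Qed.

(* Divisibility allows to correct [x] by an element of [D] so that its first
   positive multiple lying in [K + D] lies in [K]. *)
Lemma pure_translate K x : sub_closed K -> K 0 -> ~ sumD K x ->
  exists2 y, ~ sumD K y & forall n : int, sumD K (y *~ n) -> K (y *~ n).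
Proof.
move=> Ks K0 xKD.
have KD0 k : K k -> sumD K k by exists k, 0; rewrite addr0.
have KDs := sumD_sub_closed Ks.
have KDN y : sumD K y -> sumD K (- y).
  by move=> ?; rewrite -sub0r; apply: KDs => //; exact: KD0.
have [[n0 n0P]|nex] := pselect (exists n : nat, (0 < n)%N && `[< sumD K (x *+ n) >]).
  have exn : exists n : nat, (0 < n)%N && `[< sumD K (x *+ n) >] by exists n0.
  have [n /andP[n_gt0 /asboolP[k [d [Kk Dd xn]]]] n_min] := ex_minnP exn.
  have [d' Dd' d'n] := D_div n_gt0 Dd.
  have yKD (m : int) : sumD K ((x - d') *~ m) -> sumD K (x *~ m).
    move=> ym; rewrite (_ : x *~ m = (x - d') *~ m - - (d' *~ m)); last first.
      by rewrite opprK mulrzBl subrK.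
    apply: KDs => //; exists 0, (- (d' *~ m)); split=> //; last by rewrite add0r.
    by rewrite -mulrNz; exact: sub_closed_mulrz.
  have yn : (x - d') *~ n%:Z = k by rewrite mulrzBl -!pmulrn xn d'n addrK.
  exists (x - d'); first by move=> /(yKD 1).
  (* By minimality of [n] the remainder of [z] modulo [n] is zero, and the multiple of [y] by [n] is
     [k], an element of [K]. *)
  move=> z yz; rewrite (divz_eq z n) in yz *.
  have nz : n%:Z != 0 by rewrite -lt0n.
  have Kq : K ((x - d') *~ ((z %/ n)%Z * n)).
    by rewrite mulrC mulrzA yn; exact: sub_closed_mulrz.
  have : sumD K ((x - d') *~ (z %% n)%Z).
    have -> : (z %% n)%Z = ((z %/ n)%Z * n + (z %% n)%Z) - (z %/ n)%Z * n by ring.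
    rewrite mulrzBr.
    by apply: KDs => //; exact: KD0.
  move/yKD; have := modz_ge0 z nz; have := ltz_mod z nz.
  case: (z %% n)%Z => // r; rewrite ger0_norm// ltz_nat => rn _.
  case: r rn => [_ _|r rn xr]; first by rewrite addr0.
  suff /n_min : (0 < r.+1)%N && `[< sumD K (x *+ r.+1) >] by rewrite leqNgt rn.
  exact/asboolP.
(* Here no nonzero multiple of [x] lies in [K + D], so [x] needs no correction. *)
exists x; first exact: xKD.
case=> [[|n]|n] xn; first by rewrite mulr0z.
  by exfalso; apply: nex; exists n.+1; exact/asboolP.
exfalso; apply: nex; exists n.+1; apply/asboolP.
by move: xn; rewrite NegzE mulrNz => /KDN; rewrite opprK.
Qed.

(** A divisible subgroup is a direct summand: by Zorn, take [K] maximal among the subgroups meeting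
    [D] trivially. If [K + D] were proper, the element from [pure_translate] would enlarge [K]. *)
Lemma divisible_complement : exists K : set A,
  [/\ sub_closed K, forall x, K x -> D x -> x = 0 & forall x, sumD K x].
Proof.
pose P (K : set A) := sub_closed K /\ forall x, K x -> D x -> x = 0.
have [F FP Ftot|K [[Ks KD] Kmax]] := @Zorn_bigcup A P.
  split=> [x y [X FX Xx] [Y FY Yy]|x [X FX Xx]]; last exact: (FP X FX).2.
  have [XY|YX] := Ftot _ _ FX FY.
    by exists Y => //; apply: (FP Y FY).1 => //; exact: XY.
  by exists X => //; apply: (FP X FX).1 => //; exact: YX.
exists K; split => // x; apply: contrapT => xKD.
(* The empty set satisfies [P] as well; maximality against the zero subgroup excludes it. *)
have K0 : K 0.
  apply: contrapT => nK0; apply: (Kmax [set 0]).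
    split; last by move=> /(_ 0 erefl).
    move=> y Ky; exfalso; apply: nK0; rewrite -(subrr y); exact: Ks.
  by split=> [y z -> ->|y ->//]; rewrite subr0.
have [y yKD yK] := pure_translate Ks K0 xKD.
have KN z : K z -> K (- z) by move=> Kz; rewrite -sub0r; exact: Ks.
apply: (Kmax [set z | exists k n, K k /\ z = k + y *~ n]).
  split=> [k Kk|KK]; first by exists k, 0; rewrite addr0.
  apply: yKD; exists y, 0; split=> //; last by rewrite addr0.
  by apply: KK; exists 0, 1; rewrite add0r.
split=> [_ _ [k [n [Kk ->]]] [k' [n' [Kk' ->]]]|_ [k [n [Kk ->]]] Dz].
  exists (k - k'), (n - n'); split; first exact: Ks.
  by rewrite mulrzBr opprD addrACA.
apply: KD => //; rewrite -[k]opprK addrC; apply: Ks; last exact: KN.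
by apply: yK; exists (- k), (k + y *~ n); split; [exact: KN| |rewrite addKr].
Qed.

End DivisibleComplement.

(** * The extension of a group by the circle and its splitting *)

Section CircleExtension.
Variables (R : realType) (H : zmodType) (mu : cocycle R H).
Hypothesis mu_sym : forall g h, mu g h = mu h g.

(* [sym] is a phantom parameter: the addition on this central extension of [H] by
   the circle is commutative only because [mu] is symmetric. *)
Record circle_ext (sym : forall g h, mu g h = mu h g) := CircleExt {
  ext_base : H; ext_val : R[i]; ext_norm : `|ext_val| = 1 }.
Local Notation E := (circle_ext mu_sym).

HB.instance Definition _ := gen_eqMixin E.
HB.instance Definition _ := gen_choiceMixin E.

Lemma ext_eq (x y : E) : ext_base x = ext_base y -> ext_val x = ext_val y -> x = y.
Proof.
case: x y => [g s s1] [h t t1] /= -> st; rewrite -st in t1 *.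
by rewrite (eq_irrelevance s1 t1).
Qed.

Fact ext_add_subproof (x y : E) :
  `|ext_val x * ext_val y * mu (ext_base x) (ext_base y)| = 1.
Proof. by rewrite !normrM !ext_norm cocycle_norm !mulr1. Qed.
Definition ext_add x y : E :=
  CircleExt mu_sym (ext_base x + ext_base y) (ext_add_subproof x y).

Definition ext_zero : E := CircleExt mu_sym 0 (normr1 _).

Fact ext_opp_subproof (x : E) :
  `|(ext_val x * mu (ext_base x) (- ext_base x))^-1| = 1.
Proof. by rewrite normfV normrM ext_norm cocycle_norm mulr1 invr1. Qed.
Definition ext_opp x : E := CircleExt mu_sym (- ext_base x) (ext_opp_subproof x).

Fact ext_addA : associative ext_add.
Proof.
move=> x y z; apply: ext_eq => /=; first by rewrite addrA.
transitivity (ext_val x * ext_val y * ext_val z *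
  (mu (ext_base y) (ext_base z) * mu (ext_base x) (ext_base y + ext_base z))).
  by ring.
by rewrite -cocycleP; ring.
Qed.
Fact ext_addC : commutative ext_add.
Proof.
move=> x y; apply: ext_eq => /=; first exact: addrC.
by rewrite mu_sym [ext_val x * _]mulrC.
Qed.
Fact ext_add0 : left_id ext_zero ext_add.
Proof.
move=> x; apply: ext_eq => /=; first exact: add0r.
by rewrite cocycle0g mul1r mulr1.
Qed.
Fact ext_addN : left_inverse ext_zero ext_opp ext_add.
Proof.
move=> x; apply: ext_eq => /=; first exact: addNr.
rewrite cocycleNg -mulrA mulVf// mulf_neq0 ?cocycle_neq0//.
exact/norm1_neq0/ext_norm.
Qed.
HB.instance Definition _ :=
  GRing.isZmodule.Build E ext_addA ext_addC ext_add0 ext_addN.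

Let circle : set E := [set x | ext_base x = 0].

Lemma ext_baseD (x y : E) : ext_base (x + y) = ext_base x + ext_base y.
Proof. by []. Qed.
(** Over [0] the addition is multiplication of values, as [mu 0 0 = 1], and an n-th root of a number
    of modulus one has modulus one. *)
Lemma ext_circle_divisible n (x : E) : (0 < n)%N -> circle x ->
  exists2 y, circle y & y *+ n = x.
Proof.
move=> n_gt0 x0; pose t := n.-root (ext_val x).
have tn : t ^+ n = ext_val x by rewrite rootCK.
have t1 : `|t| = 1.
  apply/eqP; rewrite -(@pexpr_eq1 _ _ n) ?normr_ge0// -normrX tn.
  by rewrite ext_norm.
exists (CircleExt mu_sym 0 t1) => //.
have mulE m : ext_base (CircleExt mu_sym 0 t1 *+ m) = 0 /\
    ext_val (CircleExt mu_sym 0 t1 *+ m) = t ^+ m.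
  elim: m => [|m [IH1 IH2]]; first by [].
  rewrite mulrS /= IH1 IH2 addr0; split=> //.
  by rewrite cocycle0g mulr1 exprS.
by apply: ext_eq; [rewrite (mulE n).1 x0|rewrite (mulE n).2 tn].
Qed.

(** A complement of the circle is the graph of a function [b] on [H]. Being closed under addition,
    it gives b(g + h) = b(g) b(h) mu(g, h), so the inverse of [b] is the required function. *)
Lemma symmetric_cocycle_coboundary : exists b : H -> R[i],
  (forall g, `|b g| = 1) /\ forall g h, mu g h = b g * b h * (b (g + h))^-1.
Proof.
have [||K [Ks KD Kfull]] := @divisible_complement E circle _ _ ext_circle_divisible.
- by move=> x y x0 y0; rewrite /circle /= -[LHS]/(_ - _) x0 y0 subrr.
- by [].
have lift g : exists s, exists s1 : `|s| = 1, K (CircleExt mu_sym g s1).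
  have [[h s s1] [d [Kk d0]]] := Kfull (CircleExt mu_sym g (normr1 _)).
  move=> /(congr1 (@ext_base _)); rewrite ext_baseD d0 addr0 /= => gh.
  by rewrite gh; exists s, s1.
have [b bP] := choice lift.
have K_val x : K x -> ext_val x = b (ext_base x).
  move=> Kx; have [b1 Kb] := bP (ext_base x).
  have : x - CircleExt mu_sym (ext_base x) b1 = 0.
    by apply: KD; [exact: Ks|rewrite /circle /= -[LHS]/(_ - _) subrr].
  by move/eqP; rewrite subr_eq0 => /eqP {1}->.
have b1 g : `|b g| = 1 by have [] := bP g.
exists (fun g => (b g)^-1); split=> [g|g h]; first by rewrite normfV b1 invr1.
have [sg Kg] := bP g; have [sh Kh] := bP h.
have : K (CircleExt mu_sym g sg + CircleExt mu_sym h sh).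
  rewrite -[X in _ + X]opprK; apply: (Ks) => //; rewrite -sub0r; apply: (Ks) => //.
  by rewrite -(subrr (CircleExt mu_sym h sh)); exact: Ks.
move/K_val => /= <-; rewrite invrK mulrA -invfM mulVf ?mul1r//.
by rewrite mulf_neq0 ?norm1_neq0.
Qed.

End CircleExtension.

(** * From a conjugacy to a group isomorphism *)

Section LambdaMap.
Variables (R : realType) (H K : zmodType) (phi : {additive H -> K}).
Implicit Types x y : Lambda H.

Lemma Lambda_mapE x m : Lambda_map phi x m = phi (x m). Proof. by []. Qed.

Lemma Lambda_mapD x y :
  Lambda_map phi (x + y) = Lambda_map phi x + Lambda_map phi y.
Proof. by apply: LamP => m; rewrite LamD !Lambda_mapE raddfD. Qed.

Lemma Lambda_map0 : Lambda_map phi 0 = 0.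
Proof. by apply: LamP => m; rewrite Lambda_mapE raddf0. Qed.

Lemma Lambda_map_act g x :
  Lambda_map phi (Lambda_act g x) = Lambda_act g (Lambda_map phi x).
Proof. exact: LamP. Qed.

Lemma Lambda_map_pair k l h : Lambda_map phi (lpair k l h) = lpair k l (phi h).
Proof. by apply: LamP => m; rewrite Lambda_mapE !lpairE raddfB !raddfMn. Qed.

End LambdaMap.

(** * Twists, cocycles and coboundaries as products over the plane *)

Section Products.
Variables (R : realType) (H : zmodType).

Lemma twist_pair (chi : character R H) (k l : Z2) h :
  twist chi k (lpair l 0 h) = chi h ^ det2 k l.
Proof.
have det20 : det2 k 0 = 0 by rewrite /det2 !mxE !mulr0 subr0.
have [->|l0] := eqVneq l 0.
  rewrite lpairkk det20 expr0z /twist (eq_fprod (g := fun=> 1)) ?fprod1// => m.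
  by rewrite Lam0 character0 exp1rz.
rewrite /twist (fsbigTE [fset l]%fset) ?big_seq_fset1 ?lpairl// => m.
rewrite in_fset1 => /negPf ml; rewrite lpairE ml sub0r.
have [->|_] := eqVneq m 0; first by rewrite det20 expr0z.
by rewrite oppr0 character0 exp1rz.
Qed.

(** The two supports meet only at the origin, so one factor survives. With [mut_pairC] this recovers
    [mu] in both orders of the two functions. *)
Lemma mut_pair (mu : cocycle R H) g h :
  mut mu (lpair 0 e1 g) (lpair 0 e2 h) = mu g h.
Proof.
have e02 : (0 : Z2) != e2.
  by apply/eqP => /(congr1 (fun v : Z2 => v 1 0)); rewrite !mxE.
rewrite /mut (fsbigTE [fset 0]%fset) ?big_seq_fset1 ?lpairl ?e01// => m.
rewrite in_fset1 => /negPf m0; rewrite !lpairE m0 !sub0r.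
have [->|_] := eqVneq m e1; last by rewrite oppr0 cocycle0g.
by rewrite (negPf e12) oppr0 cocycleg0.
Qed.

Lemma mut_pairC (mu : cocycle R H) g h :
  mut mu (lpair 0 e2 g) (lpair 0 e1 h) = mu g h.
Proof.
have e02 : (0 : Z2) != e2.
  by apply/eqP => /(congr1 (fun v : Z2 => v 1 0)); rewrite !mxE.
rewrite /mut (fsbigTE [fset 0]%fset) ?big_seq_fset1 ?lpairl ?e01// => m.
rewrite in_fset1 => /negPf m0; rewrite !lpairE m0 !sub0r.
have [->|_] := eqVneq m e1; last by rewrite oppr0 cocycleg0.
by rewrite (negPf e12) oppr0 cocycle0g.
Qed.

(* The coboundary of [x |-> prod_m b (x m)] is the product over the plane of
   the coboundary of [b]. *)
Definition lprod (b : H -> R[i]) (x : Lambda H) : R[i] :=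
  \big[*%R/1]_(m \in [set: Z2]) b (x m).

Lemma lprod_norm b x : (forall g, `|b g| = 1) -> `|lprod b x| = 1.
Proof. by move=> b1; exact: fprod_norm. Qed.

Lemma lprod_act b g x : lprod b (Lambda_act g x) = lprod b x.
Proof.
rewrite /lprod (fprod_act g); apply: eq_fprod => m.
by rewrite Lambda_act_at.
Qed.

Lemma lprodD b (mu nu : H -> H -> R[i]) (x y : Lambda H) : b 0 = 1 ->
  (forall g, nu g 0 = 1) -> (forall g, nu 0 g = 1) ->
  (forall g h, mu g h * b (g + h) = b g * b h * nu g h) ->
  (\big[*%R/1]_(m \in [set: Z2]) mu (x m) (y m)) * lprod b (x + y) =
  lprod b x * lprod b y * \big[*%R/1]_(m \in [set: Z2]) nu (x m) (y m).
Proof.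
move=> b0 nug0 nu0g munu.
pose A := (supp x `|` supp y)%fset.
have xA m : m \notin A -> x m = 0.
  by rewrite in_fsetU negb_or => /andP[/notin_supp].
have yA m : m \notin A -> y m = 0.
  by rewrite in_fsetU negb_or => /andP[_ /notin_supp].
have mu00 : mu 0 0 = 1.
  by have := munu 0 0; rewrite addr0 b0 !mulr1 mul1r nug0.
have x1 m : m \notin A -> b (x m) = 1 by move=> /xA ->.
have y1 m : m \notin A -> b (y m) = 1 by move=> /yA ->.
rewrite /lprod -!(@fprodM _ A)//; first by apply: eq_fprod => m; exact: munu.
- by move=> m mA; rewrite x1// y1// mulr1.
- by move=> m mA; rewrite xA// nu0g.
- by move=> m mA; rewrite xA// yA// mu00.
- by move=> m mA; rewrite LamD xA// yA// addr0.
Qed.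

End Products.

(** * The group isomorphism induced by a conjugacy *)

Section Forward.
Variables (R : realType) (Ha Hb : zmodType).
Variables (mua : cocycle R Ha) (mub : cocycle R Hb).
Variables (chia : character R Ha) (chib : character R Hb).
Variable betaa : affine -> (l2 R (Lambda Ha) -> l2 R (Lambda Ha)) ->
                (l2 R (Lambda Ha) -> l2 R (Lambda Ha)).
Variable betab : affine -> (l2 R (Lambda Hb) -> l2 R (Lambda Hb)) ->
                (l2 R (Lambda Hb) -> l2 R (Lambda Hb)).
Hypothesis betaaP : twisted_bernoulli mua chia betaa.
Hypothesis betabP : twisted_bernoulli mub chib betab.
Variable pi : (l2 R (Lambda Ha) -> l2 R (Lambda Ha)) ->
              (l2 R (Lambda Hb) -> l2 R (Lambda Hb)).
Hypothesis pi_iso : star_isomorphism (N_vN mua) (N_vN mub) pi.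
Hypothesis pi_conj : conjugates mua betaa betab pi.
Local Notation u := (N_unitary mua).
Local Notation v := (N_unitary mub).

Let pi_mem x : N_vN mua x -> N_vN mub (pi x).
Proof. exact: (iso_mem pi_iso). Qed.
Let piZ c x : N_vN mua x -> pi (c *: x) = c *: pi x.
Proof. exact: (isoZ pi_iso). Qed.
Let pi_comp x y : N_vN mua x -> N_vN mua y -> pi (x \o y) = pi x \o pi y.
Proof. exact: (iso_comp pi_iso). Qed.
Let pi_id : pi id = id.
Proof. by apply: (iso_id pi_iso); exact: id_vN. Qed.

Lemma comp_scale (c d : R[i]) (T S : l2 R (Lambda Hb) -> l2 R (Lambda Hb)) :
  linear T -> (c *: T) \o (d *: S) = (c * d) *: (T \o S).
Proof.
move=> lT; apply/funext => f; rewrite opZE -[LHS]/(c *: T (d *: S f)).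
by rewrite linearZ_op// scalerA.
Qed.

Lemma v_linear y : linear (v y).
Proof. exact: (twisted_vN_linear (u_vN mub y)). Qed.

(** As [pi] preserves adjoints and products, [pi (u x)] preserves the norm of [delta 0]. *)
Lemma pi_u_norm x c y : pi (u x) = c *: v y -> `|c| = 1.
Proof.
move=> piE; have Nadj := canonical_adj_vN (mu_tilde mua) x.
have := iso_adjoint pi_iso (u_vN mua x) Nadj (canonical_is_adjoint _ x).
move=> /(_ (delta 0) (pi (u x) (delta 0))).
rewrite -[pi _ (pi _ _)]/((pi _ \o pi _) _) -pi_comp//; last exact: u_vN.
rewrite canonicalK pi_id inner_delta /= eqxx piE opZE u_delta0.
rewrite /inner (csum_single (j := y)) => [|i /negPf iy].
  rewrite l2Z /= eqxx mulr1 -sqr_normc => /eqP.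
  by rewrite pexpr_eq1 ?normr_ge0// => /eqP.
by rewrite l2Z /= iy mulr0 mul0r.
Qed.

Lemma pi_u_mul x x' c c' y y' d z : pi (u x) = c *: v y ->
  pi (u x') = c' *: v y' -> pi (u (x + x')) = d *: v z -> c != 0 -> c' != 0 ->
  y + y' = z /\ c * c' * mut mub y y' = mut mua x x' * d.
Proof.
move=> xE x'E xx'E c0 c'0.
have := pi_comp (u_vN mua x) (u_vN mua x').
rewrite canonicalM piZ; last exact: u_vN.
rewrite xE x'E comp_scale; last exact: v_linear.
rewrite canonicalM xx'E !scalerA => /esym /u_scale_inj; apply.
by rewrite !mulf_neq0//; exact: (cocycle_neq0 (mu_tilde mub)).
Qed.

Lemma pair_hom_exists : exists phi : Ha -> Hb, forall h, exists2 c : R[i],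
  `|c| = 1 & pi (u (lpair 0 e1 h)) = c *: v (lpair 0 e1 (phi h)).
Proof.
have key h : exists h', exists2 c : R[i],
    `|c| = 1 & pi (u (lpair 0 e1 h)) = c *: v (lpair 0 e1 h').
  have [c [h' cE]] := pi_u_pair betaaP betabP pi_mem piZ pi_comp pi_id pi_conj h.
  by exists h', c; rewrite // (pi_u_norm cE).
by have [phi phiP] := choice key; exists phi.
Qed.

Lemma pair_additive_exists : exists phi : {additive Ha -> Hb},
  forall h, exists2 c : R[i],
  `|c| = 1 & pi (u (lpair 0 e1 h)) = c *: v (lpair 0 e1 (phi h)).
Proof.
have [phi phiP] := pair_hom_exists.
have phiD : {morph phi : g h / g + h}.
  move=> g h; have [c c1 cE] := phiP g; have [d d1 dE] := phiP h.
  have [e _ eE] := phiP (g + h); rewrite lpairD in eE.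
  have [+ _] := pi_u_mul cE dE eE (norm1_neq0 c1) (norm1_neq0 d1).
  move/(congr1 (fun x : Lambda Hb => x 0)).
  by rewrite LamD !lpairl// e01.
have phiB : zmod_morphism phi.
  move=> g h; apply/eqP; rewrite -(inj_eq (addIr (phi h))) -phiD subrK.
  by rewrite subrK.
pose phiA : {additive Ha -> Hb} :=
  HB.pack phi (GRing.isZmodMorphism.Build Ha Hb phi phiB).
by exists phiA.
Qed.

Section WithHom.
Variable phi : {additive Ha -> Hb}.
Hypothesis phiP : forall h, exists2 c : R[i],
  `|c| = 1 & pi (u (lpair 0 e1 h)) = c *: v (lpair 0 e1 (phi h)).

Let P (x : Lambda Ha) := exists c : R[i], `|c| = 1 /\
  pi (u x) = c *: v (Lambda_map phi x).

Let P_add x y : P x -> P y -> P (x + y).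
Proof.
move=> [c [c1 cE]] [d [d1 dE]].
pose e := (mut mua x y)^-1 * (c * d) *
  mut mub (Lambda_map phi x) (Lambda_map phi y).
exists e; split.
  by rewrite !normrM normfV !mut_norm c1 d1 !mulr1 invr1.
have nz : mut mua x y != 0 by exact: (cocycle_neq0 (mu_tilde mua)).
have := pi_comp (u_vN mua x) (u_vN mua y).
rewrite canonicalM piZ; last exact: u_vN.
rewrite cE dE comp_scale; last exact: v_linear.
rewrite canonicalM => /(congr1 (fun T => (mut mua x y)^-1 *: T)).
by rewrite !scalerA mulVf// scale1r Lambda_mapD => ->.
Qed.

Let P_act g x : P x -> P (Lambda_act g x).
Proof.
move=> [c [c1 cE]]; rewrite /P.
have [d d1 ->] := pi_u_act betaaP piZ pi_conj g x.
rewrite cE (isoZ (beta_iso betabP g)); last exact: u_vN.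
have [e e1' ->] := beta_u_norm betabP g (Lambda_map phi x).
exists (d * (c * e)); split; first by rewrite !normrM d1 c1 e1' !mulr1.
by rewrite !scalerA Lambda_map_act mulrA.
Qed.

Let P0 : P 0.
Proof.
exists 1; split; first exact: normr1.
by rewrite Lambda_map0 !u0 pi_id scale1r.
Qed.

Let P_pair01 h : P (lpair 0 e1 h).
Proof.
by have [c c1 cE] := phiP h; exists c; rewrite Lambda_map_pair.
Qed.

Let Q (m : Z2) := forall h, P (lpair m 0 h).

(** The pair from m + n to 0 is the sum of the pair from m + n to n, a translate of the pair from m
    to 0, and the pair from n to 0. *)
Let Q_add m n : Q m -> Q n -> Q (m + n).
Proof.
move=> Qm Qn h; rewrite -(lpair_trans (m + n) n 0); apply: P_add => //.
have := P_act (Aff n 1%g) (Qm h).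
by rewrite Lambda_act_pair !aff_actE0 /= !mul1mx addr0 addrC.
Qed.

Let Q_act (g : SL2Z) m : Q m -> Q (g *m m).
Proof.
move=> Qm h; have := P_act (Aff 0 g) (Qm h).
by rewrite Lambda_act_pair !aff_actE0 mulmx0 !add0r.
Qed.

Let Q_opp m : Q m -> Q (- m).
Proof.
move=> /(Q_act minus_one); congr Q.
by apply: Z2P; rewrite !Z2E !mxE; ring.
Qed.

Let Q_e1 : Q e1.
Proof. by move=> h; rewrite lpairC -lpairN. Qed.

Let Q_e2 : Q e2.
Proof.
have := Q_act rotation Q_e1; congr Q.
by apply: Z2P; rewrite !Z2E; ring.
Qed.

Let Q_mulz m (n : int) : Q m -> Q (m *~ n).
Proof.
move=> Qm.
have Qn (k : nat) : Q (m *+ k).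
  elim: k => [|k IH]; first by move=> h; rewrite mulr0n lpairkk.
  by rewrite mulrS; exact: Q_add.
case: n => n; first exact: Qn.
by rewrite NegzE mulrNz; apply: Q_opp; exact: Qn.
Qed.

Let Q_all m : Q m.
Proof.
have -> : m = e1 *~ (m 0 0) + e2 *~ (m 1 0).
  by apply: Z2P; rewrite Z2D -!scaler_int !mxE /= ?intz; ring.
by apply: Q_add; apply: Q_mulz.
Qed.

Lemma pi_u_all x : exists c : R[i], `|c| = 1 /\
  pi (u x) = c *: v (Lambda_map phi x).
Proof.
rewrite -/(P x) [x]Lambda_decomp.
by apply: (big_ind P) => [||m _]; [exact: P0|exact: P_add|exact: Q_all].
Qed.

Lemma phi_bijective : bijective phi.
Proof.
suff [inj surj] : injective phi /\ forall h, exists g, phi g = h.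
  have [psi psiK] := choice surj.
  by exists psi => // g; apply: inj; rewrite psiK.
split=> [g h gh|h].
  have [c c1 cE] := phiP g; have [d d1 dE] := phiP h.
  have : d *: u (lpair 0 e1 g) = c *: u (lpair 0 e1 h).
    apply: (iso_inj pi_iso); try by apply: twisted_vN_scale; exact: u_vN.
    by rewrite !piZ ?cE ?dE ?gh ?scalerA 1?mulrC//; exact: u_vN.
  move=> /(u_scale_inj (norm1_neq0 d1)) [+ _].
  by move/(congr1 (fun x : Lambda Ha => x 0)); rewrite !lpairl// e01.
(* For surjectivity [pi_u_pair] is applied to an inverse of [pi], given the junk value [id] outside
   the algebra. *)
have inv y : exists x, N_vN mub y -> N_vN mua x /\ pi x = y.
  have [Ny|nNy] := pselect (N_vN mub y); last by exists id.
  by have [x Nx xy] := iso_surj pi_iso Ny; exists x.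
have [rho rhoP] := choice inv.
have rho_mem x : N_vN mub x -> N_vN mua (rho x) by case/rhoP.
have rhoK x : N_vN mub x -> pi (rho x) = x by case/rhoP.
have rhoI x y : N_vN mua x -> N_vN mub y -> pi x = y -> rho y = x.
  by move=> Nx Ny xy; apply: (iso_inj pi_iso); rewrite ?rhoK//; exact: rho_mem.
have [c [g gE]] : exists c g, rho (v (lpair 0 e1 h)) = c *: u (lpair 0 e1 g).
  apply: (pi_u_pair betabP betaaP rho_mem).
  - move=> c x Nx; apply: rhoI.
    + by apply: twisted_vN_scale; exact: rho_mem.
    + exact: twisted_vN_scale.
    + by rewrite piZ ?rhoK//; exact: rho_mem.
  - move=> x y Nx Ny; apply: rhoI.
    + by apply: twisted_vN_comp; exact: rho_mem.
    + exact: twisted_vN_comp.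
    + by rewrite pi_comp ?rhoK//; exact: rho_mem.
  - by apply: rhoI; rewrite ?pi_id//; exact: id_vN.
  - move=> k x Nx; apply: rhoI.
    + by apply: (beta_vN betaaP); exact: rho_mem.
    + exact: (beta_vN betabP).
    + by rewrite pi_conj ?rhoK//; exact: rho_mem.
have [d d1 dE] := phiP g; exists g.
have := rhoK _ (u_vN mub (lpair 0 e1 h)); rewrite gE piZ; last exact: u_vN.
rewrite dE scalerA -[RHS]scale1r => /esym /u_scale_inj -/(_ (oner_neq0 _)) [+ _].
by move/(congr1 (fun x : Lambda Hb => x 0)); rewrite !lpairl// e01.
Qed.

Let phi_cocycle : exists c : Lambda Ha -> R[i],
  [/\ forall x, `|c x| = 1, forall x, pi (u x) = c x *: v (Lambda_map phi x) &
    forall x y, mut mua x y * c (x + y) =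
      c x * c y * mut mub (Lambda_map phi x) (Lambda_map phi y)].
Proof.
have [c cP] := choice pi_u_all.
have c1 x : `|c x| = 1 by case: (cP x).
have cE x : pi (u x) = c x *: v (Lambda_map phi x) by case: (cP x).
exists c; split => // x y.
by have [_ ->] := pi_u_mul (cE x) (cE y) (cE (x + y)) (norm1_neq0 (c1 x))
  (norm1_neq0 (c1 y)).
Qed.

Let mu_ratio_norm g h : `|mua g h * (mub (phi g) (phi h))^-1| = 1.
Proof. by rewrite normrM normfV !cocycle_norm invr1 mulr1. Qed.
Let mu_ratioP g h k :
  mua g h * (mub (phi g) (phi h))^-1 *
    (mua (g + h) k * (mub (phi (g + h)) (phi k))^-1) =
  mua h k * (mub (phi h) (phi k))^-1 *
    (mua g (h + k) * (mub (phi g) (phi (h + k)))^-1).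
Proof.
by rewrite mulrACA -invfM !raddfD !cocycleP [RHS]mulrACA -invfM.
Qed.
Let mu_ratiog0 g : mua g 0 * (mub (phi g) (phi 0))^-1 = 1.
Proof. by rewrite raddf0 !cocycleg0 invr1 mulr1. Qed.
Let mu_ratio0g g : mua 0 g * (mub (phi 0) (phi g))^-1 = 1.
Proof. by rewrite raddf0 !cocycle0g invr1 mulr1. Qed.
Let mu_ratio : cocycle R Ha :=
  Cocycle mu_ratio_norm mu_ratioP mu_ratiog0 mu_ratio0g.

Let mub_neq0 g h : mub g h != 0. Proof. exact: cocycle_neq0. Qed.

(** Let x and y be the pairs from 0 to [e1] and to [e2]. The relation for [c] at (x, y) and at (y,
    x) involves the same c(x + y) and c(x) c(y), so the quotient of the cocycles is symmetric. *)
Lemma phi_cohomologous : cohomologous mua (fun g h => mub (phi g) (phi h)).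
Proof.
have [c [c1 _ cM]] := phi_cocycle.
have sym g h : mu_ratio g h = mu_ratio h g.
  rewrite /=; have := cM (lpair 0 e1 g) (lpair 0 e2 h).
  have := cM (lpair 0 e2 h) (lpair 0 e1 g).
  rewrite !Lambda_map_pair !mut_pair !mut_pairC addrC => h1 h2.
  apply: (mulIf (norm1_neq0 (c1 (lpair 0 e1 g + lpair 0 e2 h)))).
  rewrite mulrAC h2 [RHS]mulrAC h1 !mulfK//; exact: mulrC.
have [b [b1 bE]] := symmetric_cocycle_coboundary sym.
exists b; split=> // g h.
by rewrite -bE /= mulfVK.
Qed.

(* Dividing [c] by [lprod b] turns it into a character of [Lambda Ha]; computing
   its value at [d_(e1 + e2) - d_0] through [e1] and through [e2] gives (3). *)
Lemma phi_character_sqr g : chia g ^+ 2 = chib (phi g) ^+ 2.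
Proof.
have [c [c1 cE cM]] := phi_cocycle.
have [b [b1 bE]] := phi_cohomologous.
have bn h : b h != 0 by exact: norm1_neq0.
have b0 : b 0 = 1.
  by have := bE 0 0; rewrite raddf0 !cocycleg0 mulr1 addr0 mulfK.
have lD x y : mut mua x y * lprod b (x + y) = lprod b x * lprod b y *
    mut mub (Lambda_map phi x) (Lambda_map phi y).
  apply: (@lprodD _ _ b mua (fun g h => mub (phi g) (phi h))) => //.
  - by move=> h; rewrite raddf0 cocycleg0.
  - by move=> h; rewrite raddf0 cocycle0g.
  - by move=> h k; rewrite bE mulrAC mulfVK.
have ln x : lprod b x != 0 by apply: norm1_neq0; exact: lprod_norm.
have cn x : c x != 0 by exact: norm1_neq0.
pose c' x := c x / lprod b x.
have c'n x : c' x != 0 by rewrite mulf_neq0// invr_eq0.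
have c'D x y : c' (x + y) = c' x * c' y.
  have mn : mut mua x y != 0 by exact: (cocycle_neq0 (mu_tilde mua)).
  have mn' : mut mub (Lambda_map phi x) (Lambda_map phi y) != 0.
    exact: (cocycle_neq0 (mu_tilde mub)).
  rewrite /c' (canRL (mulKf mn) (cM x y)) (canRL (mulKf mn) (lD x y)).
  by field; rewrite mn mn' !ln.
have c_tr k x : c (Lambda_act (Aff k 1%g) x) * twist chia k x =
    c x * twist chib k (Lambda_map phi x).
  have := pi_conj (Aff k 1%g) (u_vN mua x).
  case: (betaaP) (betabP) => _ _ _ _ tra [_ _ _ _ trb].
  rewrite tra piZ; last exact: u_vN.
  rewrite !cE (isoZ (beta_iso betabP _)); last exact: u_vN.
  rewrite trb !scalerA => /u_scale_inj [|_ <-]; last exact: mulrC.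
  by rewrite mulf_neq0 ?norm1_neq0 ?(twist_norm chia).
pose r := chib (phi g) / chia g.
have chin (z : R[i]) (n : int) : `|z| = 1 -> z ^ n != 0.
  by move=> z1; apply: norm1_neq0; rewrite norm_exprz.
(* Translation by [k] leaves [lprod b] unchanged, so only the twists of the two actions
   contribute. *)
have c'_tr k l : c' (lpair (k + l) k g) = c' (lpair l 0 g) * r ^ det2 k l.
  have := c_tr k (lpair l 0 g); rewrite Lambda_map_pair !twist_pair.
  have := lprod_act b (Aff k 1%g) (lpair l 0 g).
  rewrite Lambda_act_pair !aff_actE0 /= !mul1mx addr0 => lE tE.
  rewrite /c' lE mulrAC; congr (_ / _).
  rewrite /r exprzMl ?unitfE ?invr_eq0 ?norm1_neq0 ?character_norm//.
  by rewrite exprz_inv -invr_expz mulrA -tE mulfK// chin// character_norm.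
have key : r ^ det2 e2 e1 = r ^ det2 e1 e2.
  have s1 := c'D (lpair (e1 + e2) e1 g) (lpair e1 0 g).
  have s2 := c'D (lpair (e2 + e1) e2 g) (lpair e2 0 g).
  move: s1 s2; rewrite !lpair_trans [e2 + e1]addrC => -> .
  rewrite c'_tr [e1 + e2]addrC c'_tr => /esym.
  rewrite mulrAC [RHS]mulrAC [c' _ * c' _ in RHS]mulrC.
  by move/(mulfI (mulf_neq0 (c'n _) (c'n _))).
have d1 : det2 e2 e1 = -1 by rewrite /det2 !mxE.
have d2 : det2 e1 e2 = 1 by rewrite /det2 !mxE.
have rn : r != 0.
  by rewrite mulf_neq0 ?invr_eq0 ?norm1_neq0 ?character_norm.
move: key; rewrite d1 d2 expr1z exprN1 => key.
have r2 : r ^+ 2 = 1 by rewrite expr2 -{1}key mulVf.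
have : r ^+ 2 * chia g ^+ 2 = chib (phi g) ^+ 2.
  by rewrite -exprMn divfK// norm1_neq0// character_norm.
by rewrite r2 mul1r.
Qed.

End WithHom.

Lemma conjugacy_isomorphism : exists phi : {additive Ha -> Hb},
  [/\ bijective phi,
      forall x : Lambda Ha, exists c : R[i], `|c| = 1 /\
        pi (u x) = c *: v (Lambda_map phi x),
      cohomologous mua (fun g h => mub (phi g) (phi h)) &
      forall g : Ha, chia g ^+ 2 = chib (phi g) ^+ 2].
Proof.
have [phi phiP] := pair_additive_exists; exists phi; split.
- exact: phi_bijective.
- exact: pi_u_all.
- exact: phi_cohomologous.
- exact: phi_character_sqr.
Qed.

End Forward.

(** * From a group isomorphism to a conjugacy *)

Section Spatial.
Variables (R : realType) (I J : choiceType).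
Variables (W : l2 R I -> l2 R J) (W' : l2 R J -> l2 R I).
Hypotheses (WK : cancel W W') (WK' : cancel W' W).
Hypotheses (W_lin : linear W) (W'_lin : linear W').
Hypothesis W_norm : forall f, l2norm (W f) = l2norm f.
Hypothesis W'_norm : forall f, l2norm (W' f) = l2norm f.

Lemma spatial_bounded T : bounded_op T -> bounded_op (W' \o T \o W).
Proof.
move=> [lT [M MT]]; split; first by move=> c f g /=; rewrite W_lin lT W'_lin.
by exists M => f /=; rewrite W'_norm -(W_norm f).
Qed.

(** The scalar [c] is allowed because the canonical unitaries correspond only up to phases. Two
    applications, the second to commutants, deal with the generated algebras. *)
Lemma spatial_commutant (X : set (l2 R I -> l2 R I)) (Y : set (l2 R J -> l2 R J)) S :
  (forall A, X A -> exists (c : R[i]) B, Y B /\ W \o A \o W' = c *: B) ->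
  commutant Y S -> commutant X (W' \o S \o W).
Proof.
move=> XY [bS cS]; split; first exact: spatial_bounded.
move=> A /XY[c [B [YB AB]]]; have lS := bS.1.
have WA f : W (A f) = c *: B (W f) by rewrite -opZE -AB /= WK.
have SB f : S (B f) = B (S f).
  by have := congr1 (fun T => T f) (cS _ YB).
apply/funext => f /=; apply: (can_inj WK).
by rewrite WK' WA WA WK' linearZ_op// SB.
Qed.

End Spatial.

Lemma odd_absD (a b : int) : odd (absz (a + b)) = odd (absz a) (+) odd (absz b).
Proof. lia. Qed.

(** * A quadratic form modulo 2 on the plane *)

Section Parity.
Implicit Types k m : Z2.

Definition odd_pt m := odd (absz (m 0 0)) || odd (absz (m 1 0)).

(** Modulo 2 the disjunction of a and b is a + b + ab, a quadratic form whose polarization is the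
    determinant. *)
Lemma odd_ptD k m : odd_pt (k + m) =
  odd_pt k (+) odd_pt m (+) odd (absz (det2 k m)).
Proof.
rewrite /odd_pt /det2 !Z2D !odd_absD -mulN1r !abszM !oddM abszN1 /=.
by do 4 case: (odd _).
Qed.

(** The form vanishes exactly on 2 Z^2, which integer matrices preserve; the inverse matrix gives
    the other direction. *)
Lemma odd_pt_act (g : SL2Z) m : odd_pt (g *m m) = odd_pt m.
Proof.
have even (h : SL2Z) n : ~~ odd_pt n -> ~~ odd_pt (h *m n).
  rewrite /odd_pt !negb_or => /andP[/negPf n0 /negPf n1].
  rewrite [SL2Zval h]mx22_eta mx22_mul0 mx22_mul1 !odd_absD !abszM !oddM n0 n1.
  by rewrite !andbF.
apply/idP/idP; apply: contraTT; last first.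
  move=> /(even g^-1%g); rewrite mulmxA -[(g^-1%g : SL2Z) *m g]/(SL2Zval (g^-1 * g)%g).
  by rewrite mulVg mul1mx.
exact: even.
Qed.

Lemma exprz_sign (R : realType) (z : R[i]) (n : int) : z ^+ 2 = 1 ->
  z ^ n = z ^+ odd (absz n).
Proof.
move=> z2; have zV : z^-1 = z.
  have z0 : z != 0 by rewrite -sqrf_eq0 z2 oner_eq0.
  by apply: (mulfI z0); rewrite mulfV// -expr2 z2.
have zn (k : nat) : z ^+ k = z ^+ odd k.
  by rewrite -[in LHS](odd_double_half k) exprD -mul2n exprM z2 expr1n mulr1.
case: n => n; first exact: zn.
by rewrite NegzE -exprz_inv zV abszN; exact: zn.
Qed.

Lemma expr_addb (R : realType) (z : R[i]) (b b' : bool) : z ^+ 2 = 1 ->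
  z ^+ (b (+) b') = z ^+ b * z ^+ b'.
Proof. by move=> z2; case: b b' => [] [] /=; rewrite ?mulr1 ?mul1r// -expr2. Qed.

End Parity.

(** * The unitary implementing a given group isomorphism *)

Section Converse.
Variables (R : realType) (Ha Hb : zmodType).
Variables (mua : cocycle R Ha) (mub : cocycle R Hb).
Variables (chia : character R Ha) (chib : character R Hb).
Variable betaa : affine -> (l2 R (Lambda Ha) -> l2 R (Lambda Ha)) ->
                (l2 R (Lambda Ha) -> l2 R (Lambda Ha)).
Variable betab : affine -> (l2 R (Lambda Hb) -> l2 R (Lambda Hb)) ->
                (l2 R (Lambda Hb) -> l2 R (Lambda Hb)).
Hypothesis betaaP : twisted_bernoulli mua chia betaa.
Hypothesis betabP : twisted_bernoulli mub chib betab.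
Variables (phi : {additive Ha -> Hb}) (psi : {additive Hb -> Ha}).
Hypotheses (phiK : cancel phi psi) (psiK : cancel psi phi).
Variable b : Ha -> R[i].
Hypothesis b_norm : forall g, `|b g| = 1.
Hypothesis bE : forall g h,
  mua g h = b g * b h * (b (g + h))^-1 * mub (phi g) (phi h).
Hypothesis chi2 : forall g, chia g ^+ 2 = chib (phi g) ^+ 2.
Local Notation u := (N_unitary mua).
Local Notation v := (N_unitary mub).
Local Notation Phi := (Lambda_map phi).
Local Notation Psi := (Lambda_map psi).

Let PhiK : cancel Phi Psi.
Proof. by move=> x; apply: LamP => m; rewrite !Lambda_mapE phiK. Qed.
Let PsiK : cancel Psi Phi.
Proof. by move=> x; apply: LamP => m; rewrite !Lambda_mapE psiK. Qed.
Let Phi_bij : bijective Phi. Proof. by exists Psi. Qed.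
Let Psi_bij : bijective Psi. Proof. by exists Phi. Qed.

Let eps_norm g : `|chib (phi g) / chia g| = 1.
Proof. by rewrite normrM normfV !character_norm invr1 mulr1. Qed.
Let epsD g h : chib (phi (g + h)) / chia (g + h) =
  chib (phi g) / chia g * (chib (phi h) / chia h).
Proof. by rewrite raddfD !characterD invfM mulrACA. Qed.
(** The sign by which the two characters differ; its square is 1 by [chi2]. *)
Let eps : character R Ha := Character eps_norm epsD.

Let eps2 g : eps g ^+ 2 = 1.
Proof.
rewrite /= exprMn -chi2 exprVn divff// expf_neq0//.
exact/norm1_neq0/character_norm.
Qed.

(* [m |-> (-1)^(odd_pt m)] is an SL(2,Z)-invariant quadratic refinement of the
   bicharacter [(k, m) |-> (-1)^(det2 k m)]. *)
Let q (x : Lambda Ha) : R[i] :=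
  \big[*%R/1]_(m \in [set: Z2]) eps (x m) ^+ odd_pt m.

(** The first factor absorbs the difference of the cocycles, the second that of the characters. *)
Let phase x := lprod b x * q x.

Let b0 : b 0 = 1.
Proof.
have := bE 0 0; rewrite raddf0 !cocycleg0 mulr1 addr0 mulfK//.
exact/norm1_neq0.
Qed.

Let phase_norm x : `|phase x| = 1.
Proof.
rewrite normrM lprod_norm// fprod_norm ?mulr1// => m.
by rewrite normrX character_norm expr1n.
Qed.

Let phase_neq0 x : phase x != 0. Proof. exact: norm1_neq0. Qed.

Let phase0 : phase 0 = 1.
Proof.
rewrite /phase /lprod /q; rewrite (eq_fprod (g := fun=> 1)); last by move=> m.
rewrite [X in _ * X](eq_fprod (g := fun=> 1)) ?fprod1 ?mulr1// => m.
by rewrite Lam0 character0 expr1n.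
Qed.

Let qD x y : q (x + y) = q x * q y.
Proof.
pose A := (supp x `|` supp y)%fset.
rewrite /q -(@fprodM _ A); first last.
- move=> m; rewrite in_fsetU negb_or => /andP[_ /notin_supp ->].
  by rewrite character0 expr1n.
- move=> m; rewrite in_fsetU negb_or => /andP[/notin_supp -> _].
  by rewrite character0 expr1n.
by apply: eq_fprod => m; rewrite LamD characterD exprMn.
Qed.

Let phaseD x y : mut mua x y * phase (x + y) =
  phase x * phase y * mut mub (Phi x) (Phi y).
Proof.
rewrite /phase qD mulrA.
have -> : mut mua x y * lprod b (x + y) =
    lprod b x * lprod b y * mut mub (Phi x) (Phi y).
  apply: (@lprodD _ _ b mua (fun g h => mub (phi g) (phi h))) => //.
  - by move=> h; rewrite raddf0 cocycleg0.
  - by move=> h; rewrite raddf0 cocycle0g.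
  - by move=> h k; rewrite bE mulrAC mulfVK//; exact: norm1_neq0.
by ring.
Qed.

Let phase_lin (gamma : SL2Z) x : phase (Lambda_act (Aff 0 gamma) x) = phase x.
Proof.
rewrite /phase lprod_act; congr (_ * _); rewrite /q (fprod_act (Aff 0 gamma)).
apply: eq_fprod => m; rewrite Lambda_act_at.
by rewrite aff_actE0 add0r odd_pt_act.
Qed.

(** By [odd_ptD] the translated exponent has three terms: the one in [m] gives [q x], and the
    determinant turns the powers of [chia] into powers of [chib]. *)
Let phase_tr k x : phase (Lambda_act (Aff k 1%g) x) * twist chia k x =
  phase x * twist chib k (Phi x).
Proof.
rewrite /phase lprod_act -!mulrA; congr (_ * _).
rewrite /q (fprod_act (Aff k 1%g)) /twist.
have supp1 (F : Z2 -> Ha -> R[i]) : (forall m, F m 0 = 1) ->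
    forall m, m \notin supp x -> F m (x m) = 1.
  by move=> F0 m /notin_supp ->.
have s1 m : m \notin supp x -> chia (x m) ^ det2 k m = 1.
  by move=> /notin_supp ->; rewrite character0 exp1rz.
have s2 m : m \notin supp x -> chib (Phi x m) ^ det2 k m = 1.
  by move=> /notin_supp xm; rewrite Lambda_mapE xm raddf0 character0 exp1rz.
have s3 n m : m \notin supp x -> eps (x m) ^+ odd_pt (n m) = 1.
  by move=> /notin_supp ->; rewrite character0 expr1n.
have s4 m : m \notin supp x -> eps (x m) ^+ odd_pt k = 1 by exact: (s3 (fun=> k)).
(* The term constant in [m] disappears because the values of [x] sum to zero. *)
have epsk : \big[*%R/1]_(m \in [set: Z2]) eps (x m) ^+ odd_pt k = 1.
  case: (odd_pt k); first exact: fprod_character.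
  by rewrite (eq_fprod (g := fun=> 1)) ?fprod1.
rewrite -[RHS]mul1r -[X in _ = X * _]epsk -!(@fprodM _ (supp x))//; first last.
- by move=> m mx; rewrite Lambda_act_at s3.
- exact: (s3 id).
- by move=> m mx; rewrite (s3 id)// s2// mulr1.
apply: eq_fprod => m; rewrite Lambda_act_at aff_actE0 /= mul1mx.
rewrite odd_ptD !expr_addb ?eps2// -exprz_sign ?eps2// -!mulrA.
congr (_ * (_ * _)); rewrite -exprzMl ?unitfE ?norm1_neq0 ?character_norm//.
by rewrite /= divfK// norm1_neq0 ?character_norm.
Qed.

(** The unitary sending delta_x to phase(x) delta_(Phi x). *)
Let W : l2 R (Lambda Ha) -> l2 R (Lambda Hb) :=
  wperm Psi_bij (fun y => phase_norm (Psi y)).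
Let W'_phase x : `|(phase x)^-1| = 1.
Proof. by rewrite normfV phase_norm invr1. Qed.
Let W' : l2 R (Lambda Hb) -> l2 R (Lambda Ha) := wperm Phi_bij W'_phase.

Let WK : cancel W W'.
Proof. by move=> f; apply: l2P => x; rewrite !wpermE PhiK mulKf. Qed.
Let WK' : cancel W' W.
Proof. by move=> f; apply: l2P => x; rewrite !wpermE PsiK mulVKf. Qed.
Let W_lin : linear W. Proof. exact: wperm_linear. Qed.
Let W'_lin : linear W'. Proof. exact: wperm_linear. Qed.
Let W_norm f : l2norm (W f) = l2norm f. Proof. exact: l2norm_wperm. Qed.
Let W'_norm f : l2norm (W' f) = l2norm f. Proof. exact: l2norm_wperm. Qed.

Let pi (T : l2 R (Lambda Ha) -> l2 R (Lambda Ha)) := W \o T \o W'.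

Let pi_u x : pi (u x) = phase x *: v (Phi x).
Proof.
apply/funext => f; apply: l2P => y; rewrite opZE l2Z.
rewrite -[LHS]/(phase (Psi y) * u x (W' f) (Psi y)) !canonicalE wpermE.
have -> : Phi (Psi y - x) = y - Phi x.
  by apply: LamP => m; rewrite Lambda_mapE !LamB raddfB !Lambda_mapE psiK.
rewrite !mulrA; congr (_ * _).
(* In each coordinate the claim is the coboundary relation for [phase]. *)
have := phaseD x (Psi y - x); rewrite addrCA subrr addr0.
have -> : Phi (Psi y - x) = y - Phi x.
  by apply: LamP => m; rewrite Lambda_mapE !LamB raddfB !Lambda_mapE psiK.
rewrite -[mut _ _ _]/(mu_tilde mua _ _) -[mut mub _ _]/(mu_tilde mub _ _).
by rewrite mulrC => ->; rewrite mulrAC mulfK// mulrAC.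
Qed.

Let gens (H : zmodType) (mu : cocycle R H) :=
  let X := range (Defs.canonical (mu_tilde mu)) in X `|` adjoints X.

Let gensP (H : zmodType) (mu : cocycle R H) A : gens mu A ->
  exists (c : R[i]) x, A = c *: N_unitary mu x.
Proof.
case=> [[x _ <-]|/adjoints_canonical[x ->]]; first by exists 1, x; rewrite scale1r.
by exists (mu_tilde mu x (- x))^-1, (- x).
Qed.

Let pi_scale (c : R[i]) T : pi (c *: T) = c *: pi T.
Proof. by apply/funext => f; rewrite opZE /pi /= opZE linearZ_op. Qed.

Let pi_gens A : gens mua A -> exists (c : R[i]) B, gens mub B /\ pi A = c *: B.
Proof.
move=> /gensP[c [x ->]]; exists (c * phase x), (v (Phi x)); split.
  by left; exists (Phi x).
by rewrite pi_scale pi_u scalerA.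
Qed.

Let pi'_gens B : gens mub B ->
  exists (c : R[i]) A, gens mua A /\ W' \o B \o W = c *: A.
Proof.
move=> /gensP[c [y ->]]; exists (c * (phase (Psi y))^-1), (u (Psi y)); split.
  by left; exists (Psi y).
have piE := pi_u (Psi y); rewrite PsiK in piE.
have -> : v y = (phase (Psi y))^-1 *: pi (u (Psi y)).
  by rewrite piE scalerA mulVf// scale1r.
set d := (phase _)^-1; set x := Psi y; apply/funext => f; rewrite opZE.
rewrite -[LHS]/(W' (c *: (d *: W (u x (W' (W f)))))).
by rewrite (linearZ_op _ _ W'_lin) (linearZ_op _ _ W'_lin) !WK scalerA.
Qed.

Let pi_mem T : N_vN mua T -> N_vN mub (pi T).
Proof.
apply: (spatial_commutant WK' WK W'_lin W_lin W'_norm W_norm) => S cS.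
exists 1, (W' \o S \o W); rewrite scale1r; split => //.
exact: (spatial_commutant WK WK' W_lin W'_lin W_norm W'_norm pi_gens).
Qed.

Let pi'_mem S : N_vN mub S -> N_vN mua (W' \o S \o W).
Proof.
apply: (spatial_commutant WK WK' W_lin W'_lin W_norm W'_norm) => T cT.
exists 1, (W \o T \o W'); rewrite scale1r; split => //.
exact: (spatial_commutant WK' WK W'_lin W_lin W'_norm W_norm pi'_gens).
Qed.

Let pi_iso : star_isomorphism (N_vN mua) (N_vN mub) pi.
Proof.
split.
- split; first exact: pi_mem.
    move=> S T _ _ ST; apply/funext => f; apply: (can_inj WK).
    by have := congr1 (fun T => T (W f)) ST; rewrite /pi /= WK.
  move=> S NS; exists (W' \o S \o W); first exact: pi'_mem.
  by apply/funext => f; rewrite /pi /= !WK'.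
- move=> S T _ _; apply/funext => f.
  rewrite -[LHS]/(W (S (W' f) + T (W' f))) -[RHS]/(W (S (W' f)) + W (T (W' f))).
  by rewrite -[S _]scale1r W_lin !scale1r.
- by move=> c T _; exact: pi_scale.
- by move=> S T _ _; apply/funext => f; rewrite /pi /= WK.
- move=> S T _ _ ST f g; rewrite /pi /= -[in LHS](WK' g) inner_wperm ST.
  by rewrite -[in RHS](WK' f) inner_wperm.
Qed.

(** [W'] maps [delta 0] to [delta 0], because [phase 0 = 1]. *)
Let trace_pi T : trace (pi T) = trace T.
Proof.
rewrite /trace !inner_delta -[LHS]/(phase (Psi 0) * T (W' (delta 0)) (Psi 0)).
rewrite Lambda_map0 phase0 mul1r; congr (T _ _); apply: l2P => x.
rewrite wpermE /= -(inj_eq (can_inj PhiK)) Lambda_map0.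
have [x0|] := eqVneq (Phi x) 0; last by rewrite mulr0.
by rewrite -[x]PhiK x0 Lambda_map0 phase0 invr1 mulr1.
Qed.

Let pi_beta_u g x : pi (betaa g (u x)) = betab g (pi (u x)).
Proof.
case: g => k gamma; rewrite (beta_u betaaP) pi_scale !pi_u.
rewrite (isoZ (beta_iso betabP _)); last exact: u_vN.
rewrite (beta_u betabP) !scalerA -!Lambda_map_act; congr (_ *: _).
rewrite (aff_mulE k gamma) Lambda_actM mulrC.
have ptr := phase_tr k (Lambda_act (Aff 0 gamma) x).
by rewrite phase_lin in ptr; rewrite ptr.
Qed.

(* Both sides have the same trace after multiplication by any
   [pi (betaa g (u y)) = betab g (pi (u y))], and these operators are multiples
   of all the canonical unitaries. *)
Let pi_conj : conjugates mua betaa betab pi.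
Proof.
move=> g T NT.
have Nba S : N_vN mua S -> N_vN mua (betaa g S) by exact: (beta_vN betaaP).
have Nbb S : N_vN mub S -> N_vN mub (betab g S) by exact: (beta_vN betabP).
apply: twisted_vN_separating; [exact/pi_mem/Nba|exact/Nbb/pi_mem|].
apply: l2P => s.
(* The label [y] is chosen so that [g] moves its image under [Phi] to [- s]. *)
pose y := Psi (Lambda_act g^-1%g (- s)); pose w := pi (betaa g (u y)).
have [c c0 wE] : exists2 c : R[i], c != 0 & w = c *: v (- s).
  rewrite /w pi_beta_u pi_u (isoZ (beta_iso betabP _)); last exact: u_vN.
  have [d d1 ->] := beta_u_norm betabP g (Phi y).
  rewrite /y PsiK Lambda_actKV scalerA; eexists; last by [].
  by rewrite mulf_neq0// norm1_neq0.
have tra S : N_vN mua S -> trace (betaa g S) = trace S.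
  by move=> NS; case: betaaP => _ tr _ _ _; exact: tr.
have trb S : N_vN mub S -> trace (betab g S) = trace S.
  by move=> NS; case: betabP => _ tr _ _ _; exact: tr.
have Nu := u_vN mua y.
have : trace (w \o pi (betaa g T)) = trace (w \o betab g (pi T)).
  rewrite -(iso_comp pi_iso); [|exact: Nba|exact: Nba].
  rewrite trace_pi -(iso_comp (beta_iso betaaP g))// tra; last exact: twisted_vN_comp.
  rewrite /w pi_beta_u -(iso_comp (beta_iso betabP g)); [|exact: pi_mem|exact: pi_mem].
  rewrite trb; last by apply: twisted_vN_comp; exact: pi_mem.
  by rewrite -(iso_comp pi_iso)// trace_pi.
rewrite wE.
have trE S : trace ((c *: v (- s)) \o S) =
    c * (mu_tilde mub (- s) s * S (delta 0) s).
  by rewrite -trace_canonical_comp /trace !inner_delta.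
by rewrite !trE => /(mulfI c0)/(mulfI (cocycle_neq0 _ _ _)).
Qed.

Lemma isomorphism_conjugacy_aux : exists pi :
    (l2 R (Lambda Ha) -> l2 R (Lambda Ha)) ->
    (l2 R (Lambda Hb) -> l2 R (Lambda Hb)),
  [/\ star_isomorphism (N_vN mua) (N_vN mub) pi,
      forall x : Lambda Ha, exists c : R[i], `|c| = 1 /\
        pi (u x) = c *: v (Lambda_map phi x) &
      conjugates mua betaa betab pi].
Proof.
exists pi; split; [exact: pi_iso| |exact: pi_conj].
by move=> x; exists (phase x); rewrite pi_u.
Qed.

End Converse.

Lemma isomorphism_conjugacy (R : realType) (Ha Hb : zmodType)
  (mua : cocycle R Ha) (mub : cocycle R Hb)
  (chia : character R Ha) (chib : character R Hb)
  (betaa : affine -> (l2 R (Lambda Ha) -> l2 R (Lambda Ha)) ->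
                     (l2 R (Lambda Ha) -> l2 R (Lambda Ha)))
  (betab : affine -> (l2 R (Lambda Hb) -> l2 R (Lambda Hb)) ->
                     (l2 R (Lambda Hb) -> l2 R (Lambda Hb)))
  (betaaP : twisted_bernoulli mua chia betaa)
  (betabP : twisted_bernoulli mub chib betab) (phi : {additive Ha -> Hb}) :
  bijective phi ->
  cohomologous mua (fun g h => mub (phi g) (phi h)) ->
  (forall g : Ha, chia g ^+ 2 = chib (phi g) ^+ 2) ->
  exists pi : (l2 R (Lambda Ha) -> l2 R (Lambda Ha)) ->
              (l2 R (Lambda Hb) -> l2 R (Lambda Hb)),
    [/\ star_isomorphism (N_vN mua) (N_vN mub) pi,
        forall x : Lambda Ha, exists c : R[i], `|c| = 1 /\
          pi (N_unitary mua x) = c *: N_unitary mub (Lambda_map phi x) &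
        conjugates mua betaa betab pi].
Proof.
move=> [psi phiK psiK] [b [b1 bE]] chi2.
have psiB : zmod_morphism psi.
  by move=> g h; apply: (can_inj phiK); rewrite raddfB !psiK.
pose psiA : {additive Hb -> Ha} :=
  HB.pack psi (GRing.isZmodMorphism.Build Hb Ha psi psiB).
exact: (@isomorphism_conjugacy_aux _ _ _ _ _ _ _ _ _ betaaP betabP phi psiA
  phiK psiK b b1 bE chi2).
Qed.

Theorem theorem4p1 (R : realType) (Ha Hb : zmodType)
    (countable_Ha : countable [set: Ha]) (countable_Hb : countable [set: Hb])
    (nontrivial_Ha : exists h : Ha, h != 0)
    (nontrivial_Hb : exists h : Hb, h != 0)
    (mua : cocycle R Ha) (mub : cocycle R Hb)
    (chia : character R Ha) (chib : character R Hb)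
    (betaa : affine -> (l2 R (Lambda Ha) -> l2 R (Lambda Ha)) ->
                       (l2 R (Lambda Ha) -> l2 R (Lambda Ha)))
    (betab : affine -> (l2 R (Lambda Hb) -> l2 R (Lambda Hb)) ->
                       (l2 R (Lambda Hb) -> l2 R (Lambda Hb)))
    (betaaP : twisted_bernoulli mua chia betaa)
    (betabP : twisted_bernoulli mub chib betab) :
  (forall pi : (l2 R (Lambda Ha) -> l2 R (Lambda Ha)) ->
               (l2 R (Lambda Hb) -> l2 R (Lambda Hb)),
    star_isomorphism (N_vN mua) (N_vN mub) pi ->
    conjugates mua betaa betab pi ->
    exists phi : {additive Ha -> Hb},
      [/\ bijective phi,
          forall x : Lambda Ha, exists c : R[i], `|c| = 1 /\
            pi (N_unitary mua x) = c *: N_unitary mub (Lambda_map phi x),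
          cohomologous mua (fun g h => mub (phi g) (phi h)) &
          forall g : Ha, chia g ^+ 2 = chib (phi g) ^+ 2])
  /\
  (forall phi : {additive Ha -> Hb},
    bijective phi ->
    cohomologous mua (fun g h => mub (phi g) (phi h)) ->
    (forall g : Ha, chia g ^+ 2 = chib (phi g) ^+ 2) ->
    exists pi : (l2 R (Lambda Ha) -> l2 R (Lambda Ha)) ->
                (l2 R (Lambda Hb) -> l2 R (Lambda Hb)),
      [/\ star_isomorphism (N_vN mua) (N_vN mub) pi,
          forall x : Lambda Ha, exists c : R[i], `|c| = 1 /\
            pi (N_unitary mua x) = c *: N_unitary mub (Lambda_map phi x) &
          conjugates mua betaa betab pi]).
Proof.
split=> [pi|phi]; first exact: conjugacy_isomorphism.
exact: isomorphism_conjugacy betaaP betabP phi.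
Qed.
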